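(* Let $m,n$ be nonnegative integers (not both zero) and consider the matrix $\tau+\widehat E[-1]=\big[\delta_{ij}\tau+e_{ij}[-1](-1)^{\bar\imath}\big]_{1\le i,j\le m+n}$. For any $k\ge0$ all coefficients $s_{kl}\in\mathrm U(t^{-1}\mathfrak{gl}_{m|n}[t^{-1}])$ in the expansion $$\mathrm{str}(\tau+\widehat E[-1])^k=s_{k0}\,\tau^k+s_{k1}\,\tau^{k-1}+\dots+s_{kk}$$ are Segal–Sugawara vectors for $\widehat{\mathfrak{gl}}_{m|n}$.
   Context: The base field is $\mathbb C$. For $1\le i\le m+n$ set $\bar\imath=0$ if $i\le m$ and $\bar\imath=1$ if $i\ge m+1$; $e_{ij}$ denotes the standard basis element of $\mathfrak{gl}_{m|n}$, of parity $\bar\imath+\bar\jmath$, and $e_{ij}[r]=e_{ij}t^r$. The affine Lie superalgebra $\widehat{\mathfrak{gl}}_{m|n}=\mathfrak{gl}_{m|n}[t,t^{-1}]\oplus\mathbb CK$ has even central element $K$ and relations $$[e_{ij}[r],e_{kl}[s]]=\delta_{kj}e_{il}[r+s]-\delta_{il}e_{kj}[r+s](-1)^{(\bar\imath+\bar\jmath)(\bar k+\bar l)}+K\Big(\delta_{kj}\delta_{il}(-1)^{\bar\imath}-\frac{\delta_{ij}\delta_{kl}}{m-n}(-1)^{\bar\imath+\bar k}\Big)r\,\delta_{r,-s}$$ for $m\ne n$. To treat all $m,n$ uniformly (in particular $m=n$) the central element is rescaled by $K=K'(n-m)$, so that the last term reads $K'\big((n-m)\delta_{kj}\delta_{il}(-1)^{\bar\imath}+\delta_{ij}\delta_{kl}(-1)^{\bar\imath+\bar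 k}\big)r\,\delta_{r,-s}$; for $m=n$ the central element is $K'$. The extended Lie superalgebra $\widehat{\mathfrak{gl}}_{m|n}\oplus\mathbb C\tau$ has $\tau$ even with $[\tau,e_{ij}[r]]=-r\,e_{ij}[r-1]$ and $[\tau,K]=0$ (resp. $[\tau,K']=0$). The vacuum module (affine vertex algebra) at the critical level, $V_{n-m}(\mathfrak{gl}_{m|n})$, is the quotient of $\mathrm U(\widehat{\mathfrak{gl}}_{m|n})$ by the left ideal generated by $\mathfrak{gl}_{m|n}[t]$ and $K-(n-m)$ (in terms of the rescaled central element: $K'-1$). As a vector superspace it is identified with $\mathrm U(t^{-1}\mathfrak{gl}_{m|n}[t^{-1}])$. A Segal–Sugawara vector is an element $b\in V_{n-m}(\mathfrak{gl}_{m|n})$ such that $\mathfrak{gl}_{m|n}[t]\,b=0$. The supertrace of a matrix $X=[x_{ij}]$ is $\mathrm{str}\,X=\sum_i(-1)^{\bar\imath}x_{ii}$; powers are ordinary matrix powers with entries in $\mathrm U(\widehat{\mathfrak{gl}}_{m|n}\oplus\mathbb C\tau)$, and the expansion is obtained by moving all powers of $\tau$ to the right. *)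

(* Defs.v *)
From HB Require Import structures.
From mathcomp Require Import all_boot all_order all_algebra.
From mathcomp Require Import generic_quotient ring_quotient.
From mathcomp Require Import boolp.
From mathcomp Require Import finmap.
From mathcomp.multinomials Require Import monalg.

Set Implicit Arguments.
Unset Strict Implicit.
Unset Printing Implicit Defensive.

Import GRing.Theory.
Local Open Scope ring_scope.
Local Open Scope quotient_scope.

Section Malg.
Variables (F : fieldType) (B : choiceType).

Lemma malgUZ (c d : F) (b : B) : c *: << d *g b >> = << c * d *g b >>.
Proof. by apply/malgP => k; rewrite mcoeffZ !mcoeffU mulrnAr. Qed.

Lemma malg_sumUB (A : lalgType F) (f : B -> A) (c d : F) (b e : B) :
  let x := c *: << b >> - d *: << e >> in
  \sum_(b <- msupp x) x@_b *: f b = c *: f b - d *: f e.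
Proof.
have E (x : {malg F[B]}) :
    \sum_(b <- msupp x) x@_b *: f b = mmap (in_alg A) f x.
  by apply: eq_bigr => ? _; rewrite -mulr_algl.
by rewrite /= E (mmapB (f := in_alg A)) !malgUZ !mmapU !mulr1 /= !mulr_algl.
Qed.

End Malg.

Section FreeAlgebra.
Variables (F : fieldType) (B : choiceType).

Definition freealg : Type := {malg F[{fmonom B}]}.

HB.instance Definition _ := GRing.Lalgebra.on freealg.

Fact freealg_scaleAr (c : F) (x y : freealg) : c *: (x * y) = x * (c *: y).
Proof.
rewrite -!mul_malgC !mulrA; apply: (congr1 (fun z => z * y)).
rewrite !malgM_def fgmulUg fgmulgU; apply: eq_bigr => w _.
by rewrite mul1m mulm1 mulrC.
Qed.

HB.instance Definition _ :=
  GRing.Lalgebra_isAlgebra.Build F freealg freealg_scaleAr.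

Definition fgen (b : B) : freealg := << fmu b >>.

(* The algebra morphism freealg -> A sending fgen b to f b. *)
Definition flift (A : lalgType F) (f : B -> A) : freealg -> A :=
  mmap (in_alg A) (fun w : {fmonom B} => \prod_(b <- w) f b).

Section Lift.
Variables (A : algType F) (f : B -> A).

Let h (w : {fmonom B}) : A := \prod_(b <- w) f b.

Fact h_mmorphism : mmorphism h.
Proof.
by split=> [w1 w2|]; rewrite /h ?fmM ?big_cat // fm1 big_nil.
Qed.

HB.instance Definition _ := isMultiplicative.Build {fmonom B} A h h_mmorphism.

Fact flift_is_linear : linear (flift f).
Proof.
move=> c x y; rewrite /flift (mmapD (f := in_alg A)); congr (_ + _).
by rewrite -[RHS]mulr_algl; exact: (@mmapZ _ _ _ (in_alg A) h c x).
Qed.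

Fact flift_is_monoid_morphism : monoid_morphism (flift f).
Proof.
have H := @commr_mmap_is_multiplicative _ _ _ (in_alg A) h.
have [g w w'|HM H1] := H; last by split.
by rewrite /GRing.comm /= mulr_algl mulr_algr.
Qed.

HB.instance Definition _ :=
  GRing.isLinear.Build F freealg A *:%R (flift f) flift_is_linear.
HB.instance Definition _ :=
  GRing.isMonoidMorphism.Build freealg A (flift f) flift_is_monoid_morphism.

Lemma flift_gen b : flift f (fgen b) = f b.
Proof. by rewrite /flift /fgen mmapU /= scale1r mul1r fmU big_seq1. Qed.

Lemma fliftB : {morph flift f : x y / x - y}.
Proof. exact: raddfB. Qed.
Lemma fliftD : {morph flift f : x y / x + y}.
Proof. exact: raddfD. Qed.
Lemma fliftZ c : {morph flift f : x / c *: x}.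
Proof. exact: linearZ. Qed.
Lemma fliftM : {morph flift f : x y / x * y}.
Proof. exact: rmorphM. Qed.
Lemma flift0 : flift f 0 = 0.
Proof. exact: raddf0. Qed.
Lemma flift1 : flift f 1 = 1.
Proof. exact: rmorph1. Qed.

End Lift.
End FreeAlgebra.

(* A superspace with homogeneous basis sort, together with the brackets of    *)
(* the basis elements, extended bilinearly.                                   *)
Record superbracket (F : fieldType) := SuperBracket {
  sbasis :> choiceType;
  sparity : sbasis -> bool;
  sbr : sbasis -> sbasis -> {malg F[sbasis]}
}.

Section Enveloping.
Variables (F : fieldType) (L : superbracket F).
Local Notation T := (freealg F L).

Definition flin (x : {malg F[L]}) : T := \sum_(b <- msupp x) x@_b *: fgen F b.

Definition urel (b c : L) : T :=
  fgen F b * fgen F c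
  - (-1) ^+ (sparity b * sparity c)%N *: (fgen F c * fgen F b)
  - flin (sbr b c).

(* The two-sided ideal generated by the elements urel b c. *)
Inductive uideal_spec : T -> Prop :=
| Uideal_rel b c : uideal_spec (urel b c)
| Uideal_0 : uideal_spec 0
| Uideal_add x y : uideal_spec x -> uideal_spec y -> uideal_spec (x + y)
| Uideal_mull a x : uideal_spec x -> uideal_spec (a * x)
| Uideal_mulr a x : uideal_spec x -> uideal_spec (x * a).

Definition uideal : {pred T} := fun x => `[< uideal_spec x >].

Lemma uidealP x : reflect (uideal_spec x) (x \in uideal).
Proof. exact: asboolP. Qed.

Fact uideal_zmod_closed : zmod_closed uideal.
Proof.
split=> [|x y /uidealP xI /uidealP yI]; first exact/uidealP/Uideal_0.
by apply/uidealP/Uideal_add => //; rewrite -mulN1r; exact: Uideal_mull.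
Qed.

HB.instance Definition _ := GRing.isZmodClosed.Build T uideal uideal_zmod_closed.

Definition uea : Type := {ideal_quot uideal}.

HB.instance Definition _ := GRing.Zmodule.on uea.
HB.instance Definition _ := EqQuotient.on uea.
HB.instance Definition _ := ZmodQuotient.on uea.

Lemma uea_eqP (x y : T) : x = y %[mod uea] <-> uideal_spec (x - y).
Proof.
split=> [xy|xy].
  by apply/uidealP; rewrite Quotient.idealrBE; exact/eqP.
by apply/eqP; rewrite -(Quotient.idealrBE uideal); exact/uidealP.
Qed.

Definition upi (x : T) : uea := \pi_uea x.

Lemma upiW (P : uea -> Prop) : (forall x, P (upi x)) -> forall u, P u.
Proof. by move=> PP u; rewrite -[u]reprK; exact: PP. Qed.

Let uone : uea := upi 1.
Let umul : uea -> uea -> uea := lift_op2 uea *%R.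
Let uscale (c : F) : uea -> uea := lift_op1 uea ( *:%R c).

Let reprI (x : T) : uideal_spec (repr (upi x) - x).
Proof. by apply/uea_eqP; rewrite reprK. Qed.

Let piM (x y : T) : umul (upi x) (upi y) = upi (x * y).
Proof.
rewrite /umul; unlock; apply/uea_eqP; set x' := repr _; set y' := repr _.
have -> : x' * y' - x * y = (x' - x) * y' + x * (y' - y).
  by rewrite mulrBl mulrBr addrA subrK.
by apply: Uideal_add; [apply: Uideal_mulr|apply: Uideal_mull]; exact: reprI.
Qed.

Let piZ c (x : T) : uscale c (upi x) = upi (c *: x).
Proof.
rewrite /uscale; unlock; apply/uea_eqP; rewrite -scalerBr -mulr_algl.
exact/Uideal_mull/reprI.
Qed.

Let upiD (x y : T)   : upi (x + y) = upi x + upi y.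
Proof. exact: raddfD. Qed.

Fact umulA : associative umul.
Proof. by elim/upiW=> x; elim/upiW=> y; elim/upiW=> z; rewrite !piM mulrA. Qed.
Fact umul1 : left_id uone umul.
Proof. by elim/upiW=> x; rewrite piM mul1r. Qed.
Fact umulu1 : right_id uone umul.
Proof. by elim/upiW=> x; rewrite piM mulr1. Qed.
Fact umulDl : left_distributive umul +%R.
Proof.
by elim/upiW=> x; elim/upiW=> y; elim/upiW=> z; rewrite -upiD !piM mulrDl upiD.
Qed.
Fact umulDr : right_distributive umul +%R.
Proof.
by elim/upiW=> x; elim/upiW=> y; elim/upiW=> z; rewrite -upiD !piM mulrDr upiD.
Qed.

(* flift f kills the ideal as soon as f satisfies the relations. *)
Definition usatisfies (A : algType F) (f : L -> A) :=
  forall b c, f b * f c - (-1) ^+ (sparity b * sparity c)%N *: (f c * f b)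
              = \sum_(d <- msupp (sbr b c)) (sbr b c)@_d *: f d.

Lemma flift_flin (A : algType F) (f : L -> A) (x : {malg F[L]}) :
  flift f (flin x) = \sum_(d <- msupp x) x@_d *: f d.
Proof.
rewrite /flin (big_morph _ (fliftD f) (flift0 f)).
by apply: eq_bigr => d _; rewrite fliftZ flift_gen.
Qed.

Lemma flift_uideal (A : algType F) (f : L -> A) (x : T) :
  usatisfies f -> uideal_spec x -> flift f x = 0.
Proof.
move=> fP; elim=> [b c||y z _ y0 _ z0|a y _ y0|a y _ y0].
- have fE p q w e :
    flift f (p - e *: q - w) = flift f p - e *: flift f q - flift f w.
    by rewrite 2!fliftB fliftZ.
  apply: etrans (fE _ _ _ _) _; rewrite [flift f (flin _)]flift_flin.
  rewrite -fP; apply/eqP; rewrite subr_eq0; apply/eqP.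
  apply: (congr2 (fun p q => p - _ *: q)); apply: etrans (fliftM f _ _) _;
    exact: (congr2 *%R (flift_gen f _) (flift_gen f _)).
- exact: flift0.
- by rewrite fliftD y0 z0 addr0.
- by rewrite fliftM y0 mulr0.
- by rewrite fliftM y0 mul0r.
Qed.

Fact uone_neq0 : uone != 0.
Proof.
apply/eqP => u10.
have /uea_eqP : (1 : T) = 0 %[mod uea] by rewrite -[LHS]/uone u10 raddf0.
have fP : usatisfies (fun _ : L => 0 : F^o).
  by move=> b c; rewrite !mul0r scaler0 subr0 big1 // => d _; rewrite scaler0.
rewrite subr0 => /(flift_uideal fP); rewrite flift1 => /eqP.
by rewrite oner_eq0.
Qed.

HB.instance Definition _ :=
  GRing.Zmodule_isNzRing.Build uea umulA umul1 umulu1 umulDl umulDr uone_neq0.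

Fact uscaleA c d (u : uea) : uscale c (uscale d u) = uscale (c * d) u.
Proof. by elim/upiW: u => x; rewrite !piZ scalerA. Qed.
Fact uscale1 : left_id 1 uscale.
Proof. by elim/upiW=> x; rewrite piZ scale1r. Qed.
Fact uscaleDr : right_distributive uscale +%R.
Proof.
by move=> c; elim/upiW=> x; elim/upiW=> y; rewrite -upiD !piZ scalerDr upiD.
Qed.
Fact uscaleDl (u : uea) : {morph uscale^~ u : c d / c + d}.
Proof. by move=> c d; elim/upiW: u => x; rewrite !piZ scalerDl upiD. Qed.

HB.instance Definition _ :=
  GRing.Zmodule_isLmodule.Build F uea uscaleA uscale1 uscaleDr uscaleDl.

Let upiM (x y : T) : upi (x * y) = upi x * upi y.
Proof. exact/esym/piM. Qed.

Let upiZ c (x : T) : upi (c *: x) = c *: upi x.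
Proof. exact/esym/piZ. Qed.

Fact uscaleAl (c : F) (u v : uea) : c *: (u * v) = (c *: u) * v.
Proof.
elim/upiW: u => x; elim/upiW: v => y.
by rewrite -!(upiM, upiZ) scalerAl.
Qed.

HB.instance Definition _ := GRing.Lmodule_isLalgebra.Build F uea uscaleAl.

Fact uscaleAr (c : F) (u v : uea) : c *: (u * v) = u * (c *: v).
Proof.
elim/upiW: u => x; elim/upiW: v => y.
by rewrite -!(upiM, upiZ) scalerAr.
Qed.

HB.instance Definition _ := GRing.Lalgebra_isAlgebra.Build F uea uscaleAr.

Fact upi_is_linear : linear upi.
Proof. by move=> c x y; rewrite upiD upiZ. Qed.
Fact upi_is_monoid_morphism : monoid_morphism upi.
Proof. by split=> // x y; rewrite upiM. Qed.

HB.instance Definition _ := GRing.isLinear.Build F T uea *:%R upi upi_is_linear.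
HB.instance Definition _ :=
  GRing.isMonoidMorphism.Build T uea upi upi_is_monoid_morphism.

Definition ugen (b : L) : uea := upi (fgen F b).

Definition uin (x : {malg F[L]}) : uea := \sum_(b <- msupp x) x@_b *: ugen b.

Lemma ugen_rel b c :
  ugen b * ugen c - (-1) ^+ (sparity b * sparity c)%N *: (ugen c * ugen b)
  = uin (sbr b c).
Proof.
have uinE x : uin x = upi (flin x).
  rewrite /flin (big_morph upi upiD (raddf0 _)).
  by apply: eq_bigr => d _; rewrite upiZ.
have : upi (urel b c) = upi 0 by apply/uea_eqP; rewrite subr0; constructor.
have upiB x y : upi (x - y) = upi x - upi y by exact: raddfB.
rewrite /urel !upiB upiZ -uinE => /eqP; rewrite raddf0 subr_eq0 => /eqP <-.
by congr (_ - _ *: _); rewrite upiM.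
Qed.

(* The algebra morphism uea -> A sending ugen b to f b, when f satisfies the  *)
(* relations (otherwise its value depends on the choice of representatives).  *)
Definition ulift (A : lalgType F) (f : L -> A) (u : uea) : A := flift f (repr u).

Section ULift.
Variables (A : algType F) (f : L -> A).
Hypothesis fP : usatisfies f.

Let ulift_pi x : ulift f (upi x) = flift f x.
Proof.
apply/eqP; rewrite -subr_eq0 -fliftB; apply/eqP.
exact: (flift_uideal fP (reprI x)).
Qed.

Lemma ulift_gen b : ulift f (ugen b) = f b.
Proof. by rewrite ulift_pi flift_gen. Qed.

Lemma ulift_is_linear : linear (ulift f).
Proof.
move=> c; elim/upiW=> x; elim/upiW=> y.
by rewrite -upiZ -upiD !ulift_pi fliftD fliftZ.
Qed.

Lemma ulift_is_monoid_morphism : monoid_morphism (ulift f).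
Proof.
split; first by rewrite -[1]/(upi 1) ulift_pi flift1.
by elim/upiW=> x; elim/upiW=> y; rewrite -upiM !ulift_pi fliftM.
Qed.

End ULift.

Lemma uea_ind (P : uea -> Prop) :
  P 1 -> (forall b, P (ugen b)) ->
  (forall c u v, P u -> P v -> P (c *: u + v)) ->
  (forall u v, P u -> P v -> P (u * v)) ->
  forall u, P u.
Proof.
move=> P1 Pg PD PM.
have P0 : P 0 by rewrite -(addNr 1) -scaleN1r; exact: PD.
have Pw (w : {fmonom L}) : P (upi << w >>).
  case: w => w; elim: w => [|b w IHw].
    by have -> : FMonom [::] = mone :> {fmonom L} by apply/val_inj; rewrite /= fm1.
  have -> : FMonom (b :: w) = mmul (fmu b) (FMonom w) :> {fmonom L}.
    by apply/val_inj; rewrite /= fmM fmU.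
  have -> : << mmul (fmu b) (FMonom w) >> = fgen F b * << FMonom w >> :> T.
    by rewrite malgM_def fgmulUU mulr1.
  by rewrite upiM; exact: (PM _ _ (Pg b) IHw).
elim/upiW=> x; rewrite (monalgE x) (big_morph upi upiD (raddf0 _)).
elim: (msupp x : seq _) => [|w r IHr]; first by rewrite big_nil.
rewrite big_cons -[X in upi << X *g w >>]mulr1 -malgUZ.
by rewrite upiZ; exact: (PD _ _ _ (Pw w) IHr).
Qed.

End Enveloping.

Section LeftQuotient.
Variables (A : nzRingType) (S : A -> Prop).

(* The left ideal generated by S. *)
Inductive lideal_spec : A -> Prop :=
| Lideal_gen x : S x -> lideal_spec x
| Lideal_0 : lideal_spec 0
| Lideal_add x y : lideal_spec x -> lideal_spec y -> lideal_spec (x + y)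
| Lideal_mull a x : lideal_spec x -> lideal_spec (a * x).

Definition lideal : {pred A} := fun x => `[< lideal_spec x >].

Lemma lidealP x : reflect (lideal_spec x) (x \in lideal).
Proof. exact: asboolP. Qed.

Fact lideal_zmod_closed : zmod_closed lideal.
Proof.
split=> [|x y /lidealP xI /lidealP yI]; first exact/lidealP/Lideal_0.
by apply/lidealP/Lideal_add => //; rewrite -mulN1r; exact: Lideal_mull.
Qed.

HB.instance Definition _ := GRing.isZmodClosed.Build A lideal lideal_zmod_closed.

(* The left A-module A / lideal. *)
Definition lquot : Type := {ideal_quot lideal}.

HB.instance Definition _ := GRing.Zmodule.on lquot.
HB.instance Definition _ := EqQuotient.on lquot.
HB.instance Definition _ := ZmodQuotient.on lquot.

Definition lpi (x : A) : lquot := \pi_lquot x.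

Lemma lpi_eqP (x y : A) : lpi x = lpi y <-> lideal_spec (x - y).
Proof.
split=> [xy|xy].
  by apply/lidealP; rewrite Quotient.idealrBE; exact/eqP.
by apply/eqP; rewrite /lpi -(Quotient.idealrBE lideal); exact/lidealP.
Qed.

Lemma lpiW (P : lquot -> Prop) : (forall x, P (lpi x)) -> forall v, P v.
Proof. by move=> PP v; rewrite -[v]reprK; exact: PP. Qed.

Let lscale (a : A) : lquot -> lquot := lift_op1 lquot ( *%R a).

Let lscaleE a x : lscale a (lpi x) = lpi (a * x).
Proof.
rewrite /lscale; unlock; apply/lpi_eqP; rewrite -mulrBr.
by apply/Lideal_mull/lpi_eqP; rewrite /lpi reprK.
Qed.

Let lpiD x y : lpi (x + y) = lpi x + lpi y.
Proof. exact: raddfD. Qed.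

Fact lscaleA a b v : lscale a (lscale b v) = lscale (a * b) v.
Proof. by elim/lpiW: v => x; rewrite !lscaleE mulrA. Qed.
Fact lscale1 : left_id 1 lscale.
Proof. by elim/lpiW=> x; rewrite lscaleE mul1r. Qed.
Fact lscaleDr : right_distributive lscale +%R.
Proof.
by move=> a; elim/lpiW=> x; elim/lpiW=> y; rewrite -lpiD !lscaleE mulrDr lpiD.
Qed.
Fact lscaleDl v : {morph lscale^~ v : a b / a + b}.
Proof. by move=> a b; elim/lpiW: v => x; rewrite !lscaleE mulrDl lpiD. Qed.

HB.instance Definition _ :=
  GRing.Zmodule_isLmodule.Build A lquot lscaleA lscale1 lscaleDr lscaleDl.

Fact lpi_is_linear : linear (lpi : A^o -> lquot).
Proof. by move=> a x y; rewrite lpiD -lscaleE. Qed.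

HB.instance Definition _ :=
  GRing.isLinear.Build A A^o lquot *:%R lpi lpi_is_linear.

End LeftQuotient.

Section AffineGl.
Variables (F : fieldType) (m n : nat).
Local Notation I := 'I_(m + n).

Definition bar (i : I) : nat := (m <= i)%N.

Definition epar (i j : I) : bool := odd (bar i + bar j).

(* The bracket of e_ij[r] with e_kl[s], where e and K name the elements       *)
(* e_ij[r] and K' of the basis T. The central element is rescaled, so that    *)
(* K = (n - m) K' when m != n; the critical level is thus K' = 1 for all m, n. *)
Definition aff_br (T : choiceType) (e : I -> I -> int -> T) (K : T)
    (i j : I) (r : int) (k l : I) (s : int) : {malg F[T]} :=
    (k == j)%:R *: << e i l (r + s) >>
  - ((i == l)%:R * (-1) ^+ ((bar i + bar j) * (bar k + bar l)))
      *: << e k j (r + s) >>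
  + (((n%:R - m%:R) * (k == j)%:R * (i == l)%:R * (-1) ^+ bar i
      + (i == j)%:R * (k == l)%:R * (-1) ^+ (bar i + bar k))
     * r%:~R * (r == - s)%:R) *: << K >>.

(* Basis of the affine Lie superalgebra: Some (i, j, r) is e_ij[r] and None   *)
(* is the rescaled central element K'.                                        *)
Definition aff_basis : choiceType := option (I * I * int).

Definition aff_par (x : aff_basis) : bool :=
  if x is Some (i, j, _) then epar i j else false.

Definition aff_bracket (x y : aff_basis) : {malg F[aff_basis]} :=
  match x, y with
  | Some (i, j, r), Some (k, l, s) =>
      aff_br (fun a b t => Some (a, b, t) : aff_basis) None i j r k l s
  | _, _ => 0
  end.

Definition glhat : superbracket F := SuperBracket aff_par aff_bracket.

(* Basis of the extension by tau: Some x is x in aff_basis and None is tau.   *)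
Definition ext_basis : choiceType := option aff_basis.

Definition ext_e (i j : I) (r : int) : ext_basis := Some (Some (i, j, r)).
Definition ext_K : ext_basis := Some None.
Definition ext_tau : ext_basis := None.

Definition ext_par (x : ext_basis) : bool := if x is Some y then aff_par y else false.

Definition ext_bracket (x y : ext_basis) : {malg F[ext_basis]} :=
  match x, y with
  | Some (Some (i, j, r)), Some (Some (k, l, s)) =>
      aff_br ext_e ext_K i j r k l s
  | None, Some (Some (i, j, r)) => - r%:~R *: << ext_e i j (r - 1) >>
  | Some (Some (i, j, r)), None => r%:~R *: << ext_e i j (r - 1) >>
  | _, _ => 0
  end.

Definition glhat_tau : superbracket F := SuperBracket ext_par ext_bracket.

(* Basis of t^-1 gl[t^-1]: (i, j, a) is e_ij[- a - 1].                        *)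
Definition neg_basis : choiceType := (I * I * nat)%type.

Definition neg_par (x : neg_basis) : bool := let: (i, j, _) := x in epar i j.

Definition neg_bracket (x y : neg_basis) : {malg F[neg_basis]} :=
  let: (i, j, a) := x in let: (k, l, b) := y in
    (k == j)%:R *: << (i, l, (a + b).+1) >>
  - ((i == l)%:R * (-1) ^+ ((bar i + bar j) * (bar k + bar l)))
      *: << (k, j, (a + b).+1) >>.

Definition glneg : superbracket F := SuperBracket neg_par neg_bracket.

(* Note that Negz a is - (a + 1). *)
Definition neg_to_aff (x : glneg) : glhat :=
  let: (i, j, a) := x in Some (i, j, Negz a).

Definition neg_to_ext (x : glneg) : glhat_tau := Some (neg_to_aff x).

Definition uneg_to_aff : uea glneg -> uea glhat :=
  ulift (fun x => ugen (neg_to_aff x)).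

Definition uneg_to_ext : uea glneg -> uea glhat_tau :=
  ulift (fun x => ugen (neg_to_ext x)).

(* gl[t] *)
Definition glt (x : {malg F[glhat]}) : Prop :=
  forall b : glhat, b \in msupp x ->
    exists i j (r : nat), b = Some (i, j, r%:Z).

Definition vacuum_rel (u : uea glhat) : Prop :=
  (exists2 x, glt x & u = uin x) \/ u = ugen (None : glhat) - 1.

Definition vacuum : lmodType (uea glhat) := lquot vacuum_rel.

Definition vac_of (u : uea glneg) : vacuum := lpi vacuum_rel (uneg_to_aff u).

Definition segal_sugawara (v : vacuum) : Prop :=
  forall x : {malg F[glhat]}, glt x -> uin x *: v = 0.

Definition str (A : pzRingType) (X : 'M[A]_(m + n)) : A :=
  \sum_i (-1) ^+ bar i * X i i.

Definition tau : uea glhat_tau := ugen (ext_tau : glhat_tau).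

Definition tauE : 'M[uea glhat_tau]_(m + n) :=
  \matrix_(i, j) (tau *+ (i == j)
                  + (-1) ^+ bar i * ugen (ext_e i j (- 1) : glhat_tau)).

Definition tau_expansion (k : nat) (s : 'I_k.+1 -> uea glneg) : Prop :=
  str (tauE ^+ k) = \sum_(l < k.+1) uneg_to_ext (s l) * tau ^+ (k - l).

Lemma uneg_to_aff_satisfies :
  usatisfies (fun x : glneg => ugen (neg_to_aff x)).
Proof.
move=> [[i j] a] [[k l] b]; rewrite [LHS]ugen_rel /uin [RHS]malg_sumUB /=.
by rewrite /aff_br mulr0 scale0r addr0 [LHS]malg_sumUB.
Qed.

Lemma uneg_to_ext_satisfies :
  usatisfies (fun x : glneg => ugen (neg_to_ext x)).
Proof.
move=> [[i j] a] [[k l] b]; rewrite [LHS]ugen_rel /uin [RHS]malg_sumUB /=.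
by rewrite /aff_br mulr0 scale0r addr0 [LHS]malg_sumUB.
Qed.

End AffineGl.

(* Main.v *)
Require Import Defs.
From HB Require Import structures.
From mathcomp Require Import all_boot all_order all_algebra.
From mathcomp Require Import generic_quotient ring_quotient.
From mathcomp Require Import boolp functions.
From mathcomp Require Import finmap.
From mathcomp.multinomials Require Import monalg.
From mathcomp Require Import reals.
From mathcomp.real_closed Require Import complex.
From mathcomp Require Import ring.

Set Implicit Arguments.
Unset Strict Implicit.
Unset Printing Implicit Defensive.

Import Order.TTheory GRing.Theory Num.Theory.
Local Open Scope ring_scope.

(* The matrix X = tau + Ehat[-1] is a super Manin matrix, and so is the        *)
(* resolvent (1 - uX)^-1. The latter says exactly that, in the computation of *)
(* e_ij[1] str X^k on a vector killed by all e_ij[0] and e_ij[1] at the       *)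
(* critical level, the terms left after the level has cancelled add up to 0.  *)
(* The elements e_ij[0], e_ij[1] do not generate gl[t] (for m = n), so the    *)
(* larger modes are reached by the conformal operators D_a = -t^(a+1) d/dt,   *)
(* [D_a, e_ij[r]] = - r e_ij[r+a]: the span of all vectors                    *)
(* str X^k1 ... str X^kj v0 is stable under D_0 and D_1, and                  *)
(* r e_ij[r+1] = [e_ij[r], D_1] kills it by induction on r.                   *)
(* The coefficients are separated in V[[z]], V the vacuum module, where tau   *)
(* acts as D_-1 + z: applied to the vacuum vector, sum_l s_l tau^(k-l)        *)
(* becomes sum_l s_l z^(k-l), so no Poincare-Birkhoff-Witt theorem is needed. *)

(** * Signs and matrix powers *)

(** Write X for [tau + Ehat[-1]], V for the vacuum module and [vac] for its vacuum vector, which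
    [gl[t]] kills and on which [K'] acts as 1. Let [tau] act on V[[z]] as [D_-1 + z]. Since [D_-1]
    kills [vac], applying str X^k to the constant series [vac] gives the series with coefficients
    s_l at z^(k-l) ([rho_expansion]). The modes e_ij[r] act coefficientwise, so it suffices that
    those with r >= 0 kill str X^k [vac] ([affX_supertrace_killed]).

    For r = 0, powers of X transform under gl like X, and their supertraces are invariant
    ([E0_supertrace]). For r = 1, moving e_ij[1] through X^k leaves zero modes, which are evaluated
    on powers of X applied to an invariant vector. A free index sum then produces the superdimension
    m - n, which the critical level cancels; the trace part of the cocycle cancels another term
    ([E1_term]). What remains is a quadratic identity between entries of powers of X
    ([str_power_comm]). It follows from the super Manin relations (1 - P) X_1 X_2 (1 + P) = 0: the
    sums S_k of X_2^q X_1^(k-q) (1 + P) over q <= k satisfy a two-step recurrence that preserves P S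
    = S ([symm_hsum]).

    For r >= 2, one brackets with [D_1], extended to V[[z]] by z d^2/dz^2. Applied to one supertrace
    it creates products of two, so the statement is proved for the span of all products of
    supertraces applied to the vacuum ([strspan_killed]).

    An expansion exists because the bracket with [tau] preserves U(t^-1 gl[t^-1]), so [tau] can be
    moved to the right ([tau_comm], [expands_taul]). *)

Section Sign.
Variable V : zmodType.
Implicit Types (b c : bool) (x y : V).

Definition sg b x : V := if b then - x else x.

Lemma sg0 b : sg b 0 = 0. Proof. by case: b; rewrite /= ?oppr0. Qed.
Lemma sgD b : {morph sg b : x y / x + y}.
Proof. by move=> x y; case: b => //=; rewrite opprD. Qed.
Lemma sgN b x : sg b (- x) = - sg b x. Proof. by case: b. Qed.
Lemma sgB b : {morph sg b : x y / x - y}.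
Proof. by move=> x y; rewrite sgD sgN. Qed.
Lemma sgMn b x n : sg b (x *+ n) = sg b x *+ n.
Proof. by case: b => //=; rewrite mulNrn. Qed.
Lemma sgK b c x : sg b (sg c x) = sg (b (+) c) x.
Proof. by case: b; case: c => //=; rewrite opprK. Qed.
Lemma sg_sum b (J : Type) (r : seq J) (P : pred J) (f : J -> V) :
  sg b (\sum_(i <- r | P i) f i) = \sum_(i <- r | P i) sg b (f i).
Proof. exact: (big_morph _ (sgD b) (sg0 b)). Qed.
Lemma sg_eq0 b x : (sg b x == 0) = (x == 0).
Proof. by case: b => //=; rewrite oppr_eq0. Qed.

End Sign.

Lemma sgMl (B : pzRingType) b (x y : B) : sg b x * y = sg b (x * y).
Proof. by case: b => //=; rewrite mulNr. Qed.
Lemma sgMr (B : pzRingType) b (x y : B) : x * sg b y = sg b (x * y).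
Proof. by case: b => //=; rewrite mulrN. Qed.
Lemma sgZl (B : pzRingType) (W : lmodType B) b (x : B) (w : W) :
  sg b x *: w = sg b (x *: w).
Proof. by case: b => //=; rewrite scaleNr. Qed.
Lemma sgZr (B : pzRingType) (W : lmodType B) b (x : B) (w : W) :
  x *: sg b w = sg b (x *: w).
Proof. by case: b => //=; rewrite scalerN. Qed.
Lemma mulr_sg (B : pzRingType) (b : bool) (x : B) : (-1) ^+ b * x = sg b x.
Proof. by rewrite mulr_sign. Qed.

Definition sgE := (sgMl, sgMr, sgZl, sgZr, sgK).

Section Delta.
Variables (V : nmodType) (I : finType).
Implicit Type f : I -> V.

Lemma sum_deltal f j : \sum_a f a *+ (a == j) = f j.
Proof.
by rewrite (bigD1 j) //= eqxx mulr1n big1 ?addr0 // => i /negPf ->.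
Qed.
Lemma sum_deltar f j : \sum_a f a *+ (j == a) = f j.
Proof. by under eq_bigr do rewrite eq_sym; exact: sum_deltal. Qed.

End Delta.

Section Powers.
Variables (B : nzRingType) (N : nat) (X : 'M[B]_N).

Lemma mxpow0E a b : (X ^+ 0) a b = 1 *+ (a == b).
Proof. by rewrite expr0 mxE. Qed.
Lemma mxpowSE k a b : (X ^+ k.+1) a b = \sum_c X a c * (X ^+ k) c b.
Proof. by rewrite exprS mxE. Qed.
Lemma mxpowDE k l a b : (X ^+ (k + l)) a b = \sum_c (X ^+ k) a c * (X ^+ l) c b.
Proof. by rewrite exprD mxE. Qed.

End Powers.

(** * Powers of super Manin matrices *)

Section SuperManin.
Variables (B : nzRingType) (N : nat) (p : 'I_N -> bool) (X : 'M[B]_N).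
Implicit Types (a b c d : 'I_N) (v : 'I_N -> 'I_N -> B).

Definition scomm (b : bool) (x y : B) : B := x * y - sg b (y * x).

Hypothesis two_reg : forall x : B, x + x = 0 -> x = 0.
Hypothesis manin : forall a e c f,
  scomm ((p a (+) p e) && (p c (+) p f)) (X a e) (X c f) =
  - sg ((p e && p c) (+) (p f && p c) (+) (p e && p f))
      (scomm ((p a (+) p f) && (p c (+) p e)) (X a f) (X c e)).

(* Viewing [v] as an element of C^N (x) C^N (x) B, [lact1] and [lact2] are    *)
(* the left actions of X_1 and X_2, and [flip] is the graded permutation P.   *)
Definition lact1 v a c : B := \sum_e X a e * v e c.
Definition lact2 v a c : B :=
  \sum_f sg (p a && (p c (+) p f)) (X c f * v a f).
Definition flip v a c : B := sg (p a && p c) (v c a).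

Lemma flip_lact1 v a c : flip (lact1 v) a c = lact2 (flip v) a c.
Proof.
rewrite /flip /lact1 /lact2 sg_sum; apply: eq_bigr => f _.
by rewrite sgMr sgK; congr sg; case: (p a); case: (p c); case: (p f).
Qed.

Lemma flip_lact2 v a c : flip (lact2 v) a c = lact1 (flip v) a c.
Proof.
rewrite /flip /lact1 /lact2 sg_sum; apply: eq_bigr => f _.
by rewrite sgMr sgK; congr sg; case: (p a); case: (p c); case: (p f).
Qed.

Definition symm v := forall a c, flip v a c = v a c.

(* Super Manin relations in the form (1 - P) X_1 X_2 (1 + P) = 0. *)
Lemma flip_lact12 v : symm v -> symm (lact1 (lact2 v)).
Proof.
(* The sum of [q] is the difference of the two sides. The Manin relation and the symmetry of [v]
   make [q] antisymmetric in [e] and [f], so twice its sum is 0. *)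
move=> sv a c; pose q e f : B :=
  sg ((p e && p c) (+) (p e && p f))
    (scomm ((p a (+) p e) && (p c (+) p f)) (X a e) (X c f)) * v e f.
have q_alt e f : q e f = - q f e.
  rewrite /q manin -(sv e f) /flip.
  rewrite !(mulNr, sgN, sgMr, sgMl, sgK); congr (- sg _ _).
  by case: (p e); case: (p f); case: (p c).
have : \sum_e \sum_f q e f = 0.
  apply: two_reg; rewrite {2}exchange_big -big_split big1 //= => e _.
  by rewrite -big_split big1 //= => f _; rewrite q_alt addNr.
move=> q0; apply/eqP; rewrite eq_sym -subr_eq0 -q0 /q; apply/eqP.
have -> : lact1 (lact2 v) a c =
    \sum_e \sum_f sg ((p e && p c) (+) (p e && p f)) (X a e * X c f * v e f).
  apply: eq_bigr => e _; rewrite mulr_sumr; apply: eq_bigr => f _.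
  by rewrite sgMr mulrA; congr sg; case: (p e).
have -> : flip (lact1 (lact2 v)) a c =
    \sum_e \sum_f sg ((p a && p c) (+) (p a && p f)) (X c f * X a e * v e f).
  rewrite /flip /lact1 /lact2 sg_sum.
  under eq_bigr do rewrite mulr_sumr sg_sum.
  rewrite exchange_big; apply: eq_bigr => e _; apply: eq_bigr => f _ /=.
  rewrite -(sv f e) /flip !sgMr !sgK mulrA; congr sg.
  by case: (p a); case: (p c); case: (p e); case: (p f).
rewrite -sumrB; apply: eq_bigr => e _; rewrite -sumrB; apply: eq_bigr => f _.
rewrite /scomm sgMl mulrBl sgB sgMl sgK; congr (_ - sg _ _).
by case: (p a); case: (p c); case: (p e); case: (p f).
Qed.

Lemma symm_lactD v : symm v -> symm (fun a c => lact2 v a c + lact1 v a c).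
Proof.
move=> sv a c; rewrite {1}/flip sgD -!/(flip _ a c) flip_lact1 flip_lact2.
rewrite addrC; congr (_ + _); apply: eq_bigr => e _; rewrite ?sv //.
Qed.

Section Columns.
Variables b d : 'I_N.

(* Columns (b, d) of X_1^k (1 + P), and of the coefficient of u^k in          *)
(* (1 - u X_2)^-1 (1 - u X_1)^-1 (1 + P).                                     *)
Definition resid k a c : B :=
  (X ^+ k) a b *+ (c == d) + sg (p b && p d) ((X ^+ k) a d *+ (c == b)).

Fixpoint hsum k a c : B :=
  if k is k'.+1 then lact2 (hsum k') a c + resid k a c else resid 0 a c.

Lemma resid_lact1 k a c : resid k.+1 a c = lact1 (resid k) a c.
Proof.
rewrite /lact1 /resid !mxpowSE -!sumrMnl sg_sum -big_split /=.
by apply: eq_bigr => e _; rewrite mulrDr sgMr !mulrnAr.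
Qed.

(** Unrolling the recursion gives the sum of X_2^q X_1^(k-q) (1 + P); the two summands come from 1
    and from P. *)
Lemma hsumE k a c : hsum k a c =
  \sum_(q < k.+1)
     (sg (p a && (p c (+) p d)) ((X ^+ q) c d * (X ^+ (k - q)) a b)
      + sg ((p b && p d) (+) (p a && (p c (+) p b)))
           ((X ^+ q) c b * (X ^+ (k - q)) a d)).
Proof.
have sg_delta (u : bool) i j (x : B) :
    sg (u && (p i (+) p j)) (x *+ (i == j)) = x *+ (i == j).
  by case: eqP => [->|_]; rewrite ?addbb ?andbF ?mulr0n ?sg0.
have q0 l i j u e : (X ^+ 0) i j * (X ^+ (l - 0)) u e = (X ^+ l) u e *+ (i == j).
  by rewrite mxpow0E mulr_natl subn0.
elim: k a c => [|k IHk] a c.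
  by rewrite big_ord1 /= !q0 sg_delta -sgK sg_delta.
rewrite big_ord_recl addrC /= !q0 sg_delta -sgK sg_delta; congr (_ + _).
rewrite /lact2.
rewrite /lact2; under [LHS]eq_bigr => f _ do rewrite IHk mulr_sumr sg_sum.
rewrite exchange_big; apply: eq_bigr => q _ /=.
rewrite /bump leq0n add1n subSS !mxpowSE !mulr_suml !sg_sum -big_split /=.
apply: eq_bigr => f _; rewrite mulrDr !sgMr sgD !sgK !mulrA.
by congr (sg _ _ + sg _ _); case: (p a); case: (p b); case: (p c); case: (p d);
  case: (p f).
Qed.

(* The coefficients S_k of ((1 - u X_1) (1 - u X_2))^-1 (1 + P) satisfy       *)
(* S_(k+2) = (X_1 + X_2) S_(k+1) - X_1 X_2 S_k.                               *)
Lemma symm_hsum k : symm (hsum k).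
Proof.
have resid0_symm : symm (resid 0).
  have sg_delta2 (x : B) i j u w :
      sg ((p i && p u) (+) (p j && p w)) (x *+ (i == j) *+ (u == w))
      = x *+ (i == j) *+ (u == w).
    have [->|_] := eqVneq i j; last by rewrite mulr0n mul0rn sg0.
    have [->|_] := eqVneq u w; last by rewrite mulr0n sg0.
    by rewrite addbb.
  move=> a c; rewrite /flip /resid !mxpow0E sgD sgK addrC ![_ *+ _ *+ (a == _)]mulrnAC.
  rewrite sg_delta2; congr (_ + _).
  rewrite -[X in _ = sg _ X](sg_delta2 _ a d c b) sgK; congr sg.
  by rewrite [p d && p b]andbC addbCA addbb addbF.
elim/ltn_ind: k => -[|[|k]] IHk.
- exact: resid0_symm.
- have := symm_lactD resid0_symm.
  by congr symm; apply/funext => a; apply/funext => c; rewrite -resid_lact1.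
move=> a c; have s1 := IHk k.+1 (leqnn _); have s0 := IHk k (leqW (leqnn _)).
have hS a' c' : hsum k.+2 a' c' =
   (lact2 (hsum k.+1) a' c' + lact1 (hsum k.+1) a' c')
   - lact1 (lact2 (hsum k)) a' c'.
  rewrite [LHS]/= -addrA; congr (_ + _); rewrite resid_lact1 /lact1 -sumrB.
  by apply: eq_bigr => e _; rewrite -mulrBr addrAC subrr add0r.
rewrite hS /flip hS sgB; congr (_ - _).
  exact: symm_lactD.
exact: flip_lact12.
Qed.

End Columns.

(** This is the symmetry of [hsum] for columns (a, j), read at row (a, i), with the common sign
    removed. Its summand is what [E1_term] produces. *)
Lemma str_power_comm k (a i j : 'I_N) :
  \sum_(q < k.+1)
    (sg (p a) ((X ^+ q) a a * (X ^+ (k - q)) i j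
               - (X ^+ q) i j * (X ^+ (k - q)) a a)
     + sg ((p i (+) p a) && (p a (+) p j)) ((X ^+ q) a j * (X ^+ (k - q)) i a)
     - (X ^+ q) i a * (X ^+ (k - q)) a j) = 0.
Proof.
have /eqP := symm_hsum a j k a i; rewrite /flip !hsumE -subr_eq0 sg_sum -sumrB.
rewrite -(sg_eq0 (p a (+) (p a && (p i (+) p j)))) sg_sum => /eqP H.
rewrite -[RHS]H; apply: eq_bigr => q _; rewrite !(sgB, sgD, sgK) opprD.
set u := _ a a * _; set v := _ i j * _; set w := _ a j * _; set z := _ i a * _.
rewrite [RHS]addrA [X in _ = X - _ - _]addrC [X in _ = X - _]addrAC.
have -> : z = sg false z by [].
by congr (sg _ _ - sg _ _ + sg _ _ - sg _ _); case: (p a); case: (p i); case: (p j).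
Qed.

End SuperManin.

(** * Action of gl[t] on supertraces of powers *)

Section PowerDerivation.
Variables (B : nzRingType) (N : nat) (p : 'I_N -> bool) (X D : 'M[B]_N).
Variables (x : B) (u : bool).
Hypothesis xX : forall c d,
  x * X c d = sg (u && (p c (+) p d)) (X c d * x) + D c d.

(** [x] passes the factors one at a time and leaves [D] at each position in turn. [D] stays in
    place, as its entries need not commute with those of [X]. *)
Lemma mul_mxpow k a b :
  x * (X ^+ k.+1) a b = sg (u && (p a (+) p b)) ((X ^+ k.+1) a b * x)
    + \sum_(q < k.+1) \sum_c \sum_d sg (u && (p a (+) p c))
        ((X ^+ q) a c * D c d * (X ^+ (k - q)) d b).
Proof.
elim: k a b => [|k IHk] a b.
  rewrite big_ord1 expr1 xX; congr (_ + _).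
  transitivity (\sum_c \sum_d D c d *+ (d == b) *+ (a == c)).
    by under eq_bigr do rewrite sumrMnl sum_deltal; rewrite sum_deltar.
  apply: eq_bigr => c _; apply: eq_bigr => d _.
  rewrite !mxpow0E mulr_natl mulr_natr -mulrnA mulnC mulrnA.
  have [->|_] := eqVneq a c; last by rewrite !mulr0n ?mul0r ?mul0rn sg0.
  by rewrite addbb andbF.
rewrite mxpowSE mulr_sumr mulr_suml sg_sum.
transitivity (\sum_c (sg (u && (p a (+) p b)) (X a c * (X ^+ k.+1) c b * x)
   + sg (u && (p a (+) p c)) (X a c * \sum_(q < k.+1) \sum_e \sum_d
       sg (u && (p c (+) p e)) ((X ^+ q) c e * D e d * (X ^+ (k - q)) d b))
   + D a c * (X ^+ k.+1) c b)).
  apply: eq_bigr => c _; rewrite mulrA xX mulrDl sgMl -[_ * x * _]mulrA IHk.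
  rewrite mulrDr sgD sgMr sgK mulrA; congr (sg _ _ + _ + _).
  by case: u; case: (p a); case: (p b); case: (p c).
rewrite !big_split /= -addrA; congr (_ + _); rewrite big_ord_recl addrC.
congr (_ + _).
  transitivity (\sum_c (\sum_d D c d * (X ^+ k.+1) d b) *+ (a == c)).
    by rewrite sum_deltar.
  apply: eq_bigr => c _; rewrite -sumrMnl; apply: eq_bigr => d _.
  rewrite mxpow0E mulr_natl mulrnAl subn0.
  have [->|_] := eqVneq a c; last by rewrite !mulr0n ?mul0r ?mul0rn sg0.
  by rewrite addbb andbF.
under eq_bigr do rewrite mulr_sumr sg_sum.
rewrite exchange_big; apply: eq_bigr => q _ /=.
under eq_bigr do rewrite mulr_sumr sg_sum.
rewrite exchange_big; apply: eq_bigr => e _ /=.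
under eq_bigr do rewrite mulr_sumr sg_sum.
rewrite exchange_big; apply: eq_bigr => d _ /=.
rewrite /bump leq0n add1n subSS mxpowSE !mulr_suml sg_sum.
apply: eq_bigr => c _; rewrite sgMr sgK !mulrA; congr sg.
by case: u; case: (p a); case: (p e); case: (p c).
Qed.

End PowerDerivation.

Section CriticalLevel.
Variables (B : nzRingType) (N : nat) (p : 'I_N -> bool) (X : 'M[B]_N).
Variables (E0 E1 : 'I_N -> 'I_N -> B) (L0 T1 : B).
Implicit Types i j c d : 'I_N.

Definition supertrace (Y : 'M[B]_N) : B := \sum_i sg (p i) (Y i i).
Definition superdim : B := \sum_i sg (p i) 1.

Hypothesis two_reg : forall x : B, x + x = 0 -> x = 0.
Hypothesis manin : forall a e c f,
  scomm ((p a (+) p e) && (p c (+) p f)) (X a e) (X c f) =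
  - sg ((p e && p c) (+) (p f && p c) (+) (p e && p f))
      (scomm ((p a (+) p f) && (p c (+) p e)) (X a f) (X c e)).
Hypothesis E0X : forall i j c d,
  scomm ((p i (+) p j) && (p c (+) p d)) (E0 i j) (X c d) =
  sg (p i (+) p j) (X i d) *+ (c == j)
  - sg ((p i (+) p j) && (p c (+) p d)) (X c j) *+ (i == d).
(** The last two terms are the cocycle at [K' = 1]; the critical level n - m appears as minus the
    superdimension. *)
Hypothesis E1X : forall i j c d,
  scomm ((p i (+) p j) && (p c (+) p d)) (E1 i j) (X c d) =
  E0 i j *+ (c == d) + sg (p j) (E0 i d) *+ (c == j)
  - sg (p c (+) ((p i (+) p j) && (p c (+) p d))) (E0 c j) *+ (i == d)
  - sg (p i (+) p j) superdim *+ ((c == j) && (i == d))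
  + sg (p i) 1 *+ ((i == j) && (c == d)).
Hypothesis L0X : forall c d, L0 * X c d = X c d * L0 + X c d.
Hypothesis T1X : forall c d,
  T1 * X c d = X c d * T1 + (L0 *+ 2 *+ (c == d) + sg (p c) (E0 c d)).

Variables (W : lmodType B) (v0 : W).

(** At each inner index, the contribution from the right of one factor cancels the one from the left
    of the next, so powers of [X] transform under gl like [X]. *)
Lemma E0_pow i j k a b :
  E0 i j * (X ^+ k) a b = sg ((p i (+) p j) && (p a (+) p b)) ((X ^+ k) a b * E0 i j)
   + sg (p i (+) p j) ((X ^+ k) i b) *+ (a == j)
   - sg ((p i (+) p j) && (p a (+) p b)) ((X ^+ k) a j) *+ (i == b).
Proof.
elim: k a b => [|k IHk] a b.
  rewrite !mxpow0E mulr_natr mulr_natl -addrA.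
  rewrite [X in _ = X + _](_ : _ = E0 i j *+ (a == b)).
    rewrite -[LHS]addr0; congr (_ + _); apply/esym/eqP; rewrite subr_eq0; apply/eqP.
    have [->|_] := eqVneq i b; last by rewrite !mulr0n sg0 mul0rn.
    have [->|_] := eqVneq a j; last by rewrite !mulr0n sg0 ?mul0rn.
    by rewrite !mulr1n [p j (+) p b]addbC andbb.
  have [->|_] := eqVneq a b; first by rewrite addbb andbF.
  by rewrite mulr0n sg0.
rewrite {1}mxpowSE mulr_sumr.
transitivity (\sum_c (
   sg ((p i (+) p j) && (p a (+) p b)) (X a c * (X ^+ k) c b * E0 i j)
   + sg ((p i (+) p j) (+) ((p i (+) p j) && (p a (+) p c)))
        (X a c * (X ^+ k) i b) *+ (c == j)
   - sg ((p i (+) p j) && (p a (+) p b)) (X a c * (X ^+ k) c j) *+ (i == b)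
   + sg (p i (+) p j) (X i c * (X ^+ k) c b) *+ (a == j)
   - sg ((p i (+) p j) && (p a (+) p c)) (X a j * (X ^+ k) c b) *+ (i == c))).
  apply: eq_bigr => c _; rewrite mulrA.
  rewrite -[E0 i j * X a c]
    (subrK (sg ((p i (+) p j) && (p a (+) p c)) (X a c * E0 i j))).
  rewrite -/(scomm _ _ _) E0X addrC mulrDl sgMl -[_ * E0 i j * _]mulrA IHk.
  rewrite mulrBr mulrDr mulrBl !mulrnAl !mulrnAr !sgMr !sgMl sgB sgD !sgMn !sgK !mulrA.
  rewrite !addrA; congr (sg _ _ + sg _ _ *+ _ - sg _ _ *+ _ + _ - _).
  - by case: (p i); case: (p j); case: (p a); case: (p b); case: (p c).
  - by case: (p i); case: (p j); case: (p a); case: (p b); case: (p c).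
  - by case: (p i); case: (p j); case: (p a); case: (p b); case: (p c).
rewrite !big_split /= !sumrN !sum_deltal !sum_deltar !sumrMnl -!sg_sum -mulr_suml.
rewrite -!mxpowSE.
have -> : sg (p i (+) p j (+) (p i (+) p j) && (p a (+) p j)) (X a j * (X ^+ k) i b)
   = sg ((p i (+) p j) && (p a (+) p i)) (X a j * (X ^+ k) i b).
  by congr sg; case: (p i); case: (p j); case: (p a).
have cancel (x y z t : B) : x + y - z + t - y = x + t - z.
  apply/eqP; rewrite subr_eq; apply/eqP; rewrite -!addrA; congr (_ + _).
  by rewrite addrC [- z + t]addrC -addrA.
exact: cancel.
Qed.

Section Killed.
Variable v : W.
Hypothesis E0v : forall i j, E0 i j *: v = 0.

Lemma E0_act i j k a b :
  E0 i j *: ((X ^+ k) a b *: v) =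
    sg (p i (+) p j) ((X ^+ k) i b *: v) *+ (a == j)
    - sg ((p i (+) p j) && (p a (+) p b)) ((X ^+ k) a j *: v) *+ (i == b).
Proof.
rewrite scalerA E0_pow scalerBl scalerDl -!scalerMnl !sgZl -scalerA E0v.
by rewrite scaler0 sg0 add0r.
Qed.

Lemma E0_supertrace i j k : E0 i j *: (supertrace (X ^+ k) *: v) = 0.
Proof.
rewrite scaler_suml scaler_sumr.
under eq_bigr do rewrite sgZl sgZr E0_act sgB !sgMn addbb andbF.
rewrite sumrB sum_deltal sum_deltar sgK.
by apply/eqP; rewrite subr_eq0; case: (p i); case: (p j).
Qed.

Section OneTerm.
Variables (i j : 'I_N) (q r : nat).
Local Notation Xq := (X ^+ q).
Local Notation Xr := (X ^+ r).
Local Notation pij := (p i (+) p j).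
Local Notation D c d :=
  (E0 i j *+ (c == d) + sg (p j) (E0 i d) *+ (c == j)
  - sg (p c (+) (pij && (p c (+) p d))) (E0 c j) *+ (i == d)
  - sg pij superdim *+ ((c == j) && (i == d))
  + sg (p i) 1 *+ ((i == j) && (c == d))).

(** The bracket of e_ij[1] with one factor is a zero mode, up to central terms, and [E0_act]
    evaluates it on the factors to its right. The central terms cancel two of the results. *)
Lemma E1_term :
  \sum_a \sum_c \sum_d
     sg (p a (+) (pij && (p a (+) p c))) (Xq a c *: (D c d *: (Xr d a *: v)))
  = sg (p i) (\sum_a
     (sg (p a) (Xq a a * Xr i j - Xq i j * Xr a a)
      + sg ((p i (+) p a) && (p a (+) p j)) (Xq a j * Xr i a)
      - Xq i a * Xr a j) *: v).
Proof.
pose M a c (w : W) : W := sg (p a (+) (pij && (p a (+) p c))) (Xq a c *: w).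
have MB a c : {morph M a c : x y / x - y}.
  by move=> x y; rewrite /M scalerBr sgB.
have MD a c : {morph M a c : x y / x + y}.
  by move=> x y; rewrite /M scalerDr sgD.
have Msg a c b w : M a c (sg b w) = sg b (M a c w).
  by rewrite /M sgZr !sgK addbC.
have MMn a c w n : M a c (w *+ n) = M a c w *+ n.
  by rewrite /M -scalerMnr sgMn.
pose y d a : W := Xr d a *: v.
transitivity (\sum_a (\sum_c M a c (E0 i j *: y c a)
   + \sum_d sg (p j) (M a j (E0 i d *: y d a))
   - \sum_c sg (p c (+) (pij && (p c (+) p i))) (M a c (E0 c j *: y i a))
   - sg pij (M a j (superdim *: y i a))
   + \sum_c sg (p i) (M a c (y c a)) *+ (i == j))).
  apply: eq_bigr => a _.
  transitivity (\sum_c (M a c (E0 i j *: y c a)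
   + (\sum_d sg (p j) (M a c (E0 i d *: y d a))) *+ (c == j)
   - sg (p c (+) (pij && (p c (+) p i))) (M a c (E0 c j *: y i a))
   - sg pij (M a c (superdim *: y i a)) *+ (c == j)
   + sg (p i) (M a c (y c a)) *+ (i == j))).
    apply: eq_bigr => c _.
    transitivity (\sum_d (M a c (E0 i j *: y d a) *+ (c == d)
      + sg (p j) (M a c (E0 i d *: y d a)) *+ (c == j)
      - sg (p c (+) (pij && (p c (+) p d))) (M a c (E0 c j *: y d a)) *+ (i == d)
      - sg pij (M a c (superdim *: y d a)) *+ (c == j) *+ (i == d)
      + sg (p i) (M a c (y d a)) *+ (i == j) *+ (c == d))).
      apply: eq_bigr => d _; rewrite -/(M a c _) -/(y d a).
      rewrite scalerDl !scalerBl scalerDl -!scalerMnl !sgZl scale1r.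
      by rewrite MD !MB MD !MMn !Msg -!mulrnA !mulnb.
    rewrite !big_split /= !sumrN.
    rewrite (sum_deltar (fun d => M a c (E0 i j *: y d a))).
    rewrite (sum_deltar (fun d => sg (p c (+) (pij && (p c (+) p d)))
       (M a c (E0 c j *: y d a)))).
    rewrite (sum_deltar (fun d => sg pij (M a c (superdim *: y d a)) *+ (c == j))).
    rewrite (sum_deltar (fun d => sg (p i) (M a c (y d a)) *+ (i == j))).
    by rewrite sumrMnl.
  rewrite !big_split /= !sumrN.
  rewrite (sum_deltal (fun c => \sum_d sg (p j) (M a c (E0 i d *: y d a)))).
  by rewrite (sum_deltal (fun c => sg pij (M a c (superdim *: y i a)))).
(* [A], [A'], [V] and [G] survive; [U] is cancelled by the level and [Z] by the trace part of the
   cocycle. *)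
pose A := \sum_a sg (p i (+) ((p i (+) p a) && (p a (+) p j))) (Xq a j *: y i a).
pose A' := \sum_c sg (p i) (Xq i c *: y c j).
pose V := \sum_d sg (p i (+) p d) (Xq i j *: y d d).
pose G := \sum_a sg (p i (+) p a) (Xq a a *: y i j).
pose U := \sum_a sg pij (M a j (superdim *: y i a)).
pose Z := \sum_a \sum_c sg (p i) (M a c (y c a)) *+ (i == j).
have S1 : \sum_a \sum_c M a c (E0 i j *: y c a) = A - A'.
  transitivity (\sum_a (\sum_c sg pij (M a c (y i a)) *+ (c == j)
     - (\sum_c sg (pij && (p c (+) p a)) (M a c (y c j))) *+ (i == a))).
    apply: eq_bigr => a _; rewrite -sumrMnl -sumrB; apply: eq_bigr => c _.
    by rewrite E0_act MB !MMn !Msg.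
  rewrite sumrB; congr (_ - _); last first.
    rewrite sum_deltar; apply: eq_bigr => c _; rewrite /M sgK; congr sg.
    by case: (p i); case: (p j); case: (p c).
  apply: eq_bigr => a _; rewrite sum_deltal /M sgK; congr sg.
  by case: (p i); case: (p j); case: (p a).
(* In [E0_act] the first delta is here [d == d], so the sum over [d] is free and yields the
   superdimension. *)
have S2 : \sum_a \sum_d sg (p j) (M a j (E0 i d *: y d a)) = U - V.
  transitivity (\sum_a (sg pij (M a j (superdim *: y i a))
     - (\sum_d sg (p j (+) (p i (+) p d)) (M a j (y d d))) *+ (i == a))).
    apply: eq_bigr => a _; rewrite /superdim scaler_suml.
    rewrite (big_morph _ (MD a j) (_ : M a j 0 = 0)); last first.
      by rewrite /M scaler0 sg0.
    rewrite sg_sum -sumrMnl -sumrB; apply: eq_bigr => d _.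
    rewrite E0_act eqxx mulr1n MB MMn !Msg sgB sgMn !sgK sgZl scale1r sgZr sgK.
    congr (sg _ _ - _).
      by case: (p i); case: (p j); case: (p d); case: (p a).
    by have [->|] := eqVneq i a; rewrite // [p d (+) _]addbC andbb.
  rewrite sumrB; congr (_ - _); rewrite sum_deltar; apply: eq_bigr => d _.
  by rewrite /M sgK; congr sg; case: (p i); case: (p j); case: (p d).
have S3 : \sum_a \sum_c
    sg (p c (+) (pij && (p c (+) p i))) (M a c (E0 c j *: y i a)) = Z - G.
  rewrite /Z -sumrB; apply: eq_bigr => a _.
  transitivity (\sum_c (sg (p i) (M a c (y c a)) *+ (i == j)
     - sg (p i (+) p a) (Xq a c *: y i j) *+ (c == a))); last first.
    by rewrite sumrB sum_deltal.
  apply: eq_bigr => c _; rewrite E0_act MB !MMn !Msg sgB !sgMn !sgK.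
  congr (_ - _).
    have [->|] := eqVneq i j; last by rewrite !mulr0n.
    by congr (sg _ _ *+ _); case: (p a); case: (p j); case: (p c).
  have [->|] := eqVneq c a; last by rewrite !mulr0n.
  by congr (sg _ _ *+ _); case: (p i); case: (p j); case: (p a).
rewrite !big_split /= !sumrN S1 S2 S3 -/U -/Z.
transitivity (G - V + A - A').
  rewrite opprB !addrA [_ - U + Z]addrAC subrK [_ + G - U]addrAC.
  rewrite [_ - V - U]addrAC addrK addrC [A - A' - V]addrAC [A - V]addrC.
  by rewrite !addrA.
rewrite sg_sum /G /V /A /A' -sumrB -big_split -sumrB /=.
apply: eq_bigr => a _; rewrite scalerBl scalerDl !sgZl scalerBl sgB sgD sgK sgB sgK.
by rewrite -!scalerA.
Qed.

End OneTerm.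

Hypothesis E1v : forall i j, E1 i j *: v = 0.

Lemma E1_supertrace i j k : E1 i j *: (supertrace (X ^+ k) *: v) = 0.
Proof.
case: k => [|k].
  rewrite scaler_suml scaler_sumr big1 // => a _.
  by rewrite mxpow0E eqxx sgZl scale1r sgZr E1v sg0.
have E1_mul c d : E1 i j * X c d =
    sg ((p i (+) p j) && (p c (+) p d)) (X c d * E1 i j)
    + (\matrix_(c, d)
        scomm ((p i (+) p j) && (p c (+) p d)) (E1 i j) (X c d)) c d.
  by rewrite mxE addrC subrK.
pose term q a c d : W := sg (p a (+) ((p i (+) p j) && (p a (+) p c)))
   ((X ^+ q) a c *: (scomm ((p i (+) p j) && (p c (+) p d)) (E1 i j) (X c d)
                      *: ((X ^+ (k - q)) d a *: v))).
transitivity (\sum_(q < k.+1) \sum_a \sum_c \sum_d term q a c d).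
  rewrite exchange_big /= scaler_suml scaler_sumr; apply: eq_bigr => a _.
  rewrite sgZl sgZr scalerA (mul_mxpow E1_mul) scalerDl sgZl -scalerA E1v.
  rewrite scaler0 sg0 add0r scaler_suml sg_sum; apply: eq_bigr => q _.
  rewrite scaler_suml sg_sum; apply: eq_bigr => c _.
  rewrite scaler_suml sg_sum; apply: eq_bigr => d _.
  by rewrite mxE sgZl sgK -!scalerA.
under eq_bigr => q _ do under eq_bigr => a _ do under eq_bigr => c _ do
  under eq_bigr => d _ do rewrite /term E1X.
under eq_bigr do rewrite E1_term.
rewrite -sg_sum exchange_big /= big1 ?sg0 // => a _.
by rewrite -scaler_suml (str_power_comm two_reg manin) scale0r.
Qed.
Lemma L0_pow k a b : L0 * (X ^+ k) a b = (X ^+ k) a b * L0 + (X ^+ k) a b *+ k.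
Proof.
elim: k a b => [|k IHk] a b.
  by rewrite mxpow0E mulr_natl mulr_natr mulr0n addr0.
rewrite mxpowSE mulr_sumr mulr_suml -sumrMnl -big_split.
apply: eq_bigr => c _ /=; rewrite mulrA L0X mulrDl -mulrA IHk mulrDr.
by rewrite mulrA mulrnAr mulrSr addrA.
Qed.

Lemma L0_supertrace k : L0 *: (supertrace (X ^+ k) *: v) =
  supertrace (X ^+ k) *: (L0 *: v) + (supertrace (X ^+ k) *: v) *+ k.
Proof.
rewrite !scaler_suml scaler_sumr -sumrMnl -big_split; apply: eq_bigr => a _ /=.
rewrite !sgZl sgZr scalerA L0_pow scalerDl -scalerMnl scalerA sgD.
by rewrite -sgMn.
Qed.

(** The zero mode in the bracket of [T1] with a factor joins the ends of the remaining factors and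
    cuts one supertrace into a product of two. *)
Lemma T1_supertrace k : T1 *: (supertrace (X ^+ k.+1) *: v) =
  supertrace (X ^+ k.+1) *: (T1 *: v) +
  \sum_(q < k.+1) ((supertrace (X ^+ k) *: (L0 *: v)
                    + (supertrace (X ^+ k) *: v) *+ (k - q)) *+ 2
     + superdim *: (supertrace (X ^+ k) *: v)
     - supertrace (X ^+ q) *: (supertrace (X ^+ (k - q)) *: v)).
Proof.
pose D : 'M[B]_N := \matrix_(c, d) (L0 *+ 2 *+ (c == d) + sg (p c) (E0 c d)).
have T1_mul c d : T1 * X c d = sg (false && (p c (+) p d)) (X c d * T1) + D c d.
  by rewrite mxE T1X.
transitivity (supertrace (X ^+ k.+1) *: (T1 *: v) + \sum_(q < k.+1) \sum_a
   sg (p a) (\sum_c \sum_d (X ^+ q) a c *: (D c d *: ((X ^+ (k - q)) d a *: v)))).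
  rewrite {2}/supertrace exchange_big !scaler_suml scaler_sumr -big_split.
  apply: eq_bigr => a _ /=; rewrite !sgZl sgZr scalerA (mul_mxpow T1_mul).
  rewrite scalerDl sgD -scalerA -sg_sum; congr (_ + sg _ _).
  rewrite scaler_suml; apply: eq_bigr => q _.
  rewrite scaler_suml; apply: eq_bigr => c _.
  rewrite scaler_suml; apply: eq_bigr => d _.
  by rewrite -!scalerA.
congr (_ + _); apply: eq_bigr => q _.
have XkE a : (X ^+ k) a a = \sum_c (X ^+ q) a c * (X ^+ (k - q)) c a.
  by rewrite -mxpowDE subnKC // -ltnS.
have superdimC (y : B) : y * superdim = superdim * y.
  rewrite mulr_sumr mulr_suml; apply: eq_bigr => d _.
  by rewrite sgMr sgMl mulr1 mul1r.
transitivity (\sum_a sg (p a)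
   (((X ^+ k) a a *: (L0 *: v) + ((X ^+ k) a a *: v) *+ (k - q)) *+ 2
    + superdim *: ((X ^+ k) a a *: v)
    - (X ^+ q) a a *: (supertrace (X ^+ (k - q)) *: v))).
  apply: eq_bigr => a _; congr sg.
  transitivity (\sum_c ((X ^+ q) a c *:
     (((X ^+ (k - q)) c a *: (L0 *: v) + (X ^+ (k - q)) c a *: v *+ (k - q)) *+ 2
      + superdim *: ((X ^+ (k - q)) c a *: v))
      - (X ^+ q) a c *: (supertrace (X ^+ (k - q)) *: v) *+ (c == a))).
    apply: eq_bigr => c _.
    rewrite -scaler_sumr [X in _ = _ - X]scalerMnr -scalerBr; congr (_ *: _).
    transitivity (\sum_d ((((X ^+ (k - q)) d a *: (L0 *: v)
          + (X ^+ (k - q)) d a *: v *+ (k - q)) *+ 2) *+ (c == d)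
        + sg (p d) 1 *: ((X ^+ (k - q)) c a *: v)
        - sg (p d) ((X ^+ (k - q)) d d *: v) *+ (c == a))).
      apply: eq_bigr => d _; rewrite mxE scalerDl -!scalerMnl scalerA L0_pow.
      rewrite scalerDl -scalerA -addrA; congr (_ + _).
        by rewrite -scalerMnl scalerMnr.
      rewrite !sgZl scale1r E0_act eqxx mulr1n sgB sgMn !sgK.
      rewrite addbA addbb; congr (_ - _).
      have [->|] := eqVneq c a; last by rewrite !mulr0n.
      by congr (sg _ _ *+ _); case: (p a); case: (p d).
    rewrite sumrB big_split /= sum_deltar -scaler_suml; congr (_ - _).
    by rewrite sumrMnl scaler_suml; congr (_ *+ _); apply: eq_bigr => d _; rewrite sgZl.
  rewrite sumrB sum_deltal; congr (_ - _).
  move: superdim superdimC => S SC; rewrite XkE !scaler_suml -!sumrMnl.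
  rewrite -big_split -sumrMnl scaler_sumr -big_split.
  apply: eq_bigr => c _ /=; rewrite scalerDr -scalerMnr scalerDr -scalerMnr !scalerA.
  by rewrite SC !mulrA.
move: superdim {superdimC} => S.
rewrite !scaler_suml -!sumrMnl -big_split -sumrMnl scaler_sumr -big_split -sumrB.
apply: eq_bigr => a _ /=; rewrite !sgZl sgZr sgB sgD !sgMn sgD.
by rewrite -sgMn.
Qed.

End Killed.

(** Products of supertraces are included because [T1] creates them. Additive closure is enough,
    since all coefficients that occur, the superdimension among them, are integers. *)
Inductive strspan : W -> Prop :=
| strspan_base : strspan v0
| strspan_sub x y : strspan x -> strspan y -> strspan (x - y)
| strspan_str k x : strspan x -> strspan (supertrace (X ^+ k) *: x).

Lemma strspan0 : strspan 0.
Proof. by rewrite -(subrr v0); apply: strspan_sub; exact: strspan_base. Qed.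

Lemma strspanN x : strspan x -> strspan (- x).
Proof. by rewrite -sub0r; apply: strspan_sub strspan0. Qed.

Lemma strspanD x y : strspan x -> strspan y -> strspan (x + y).
Proof. by move=> sx sy; rewrite -[y]opprK; exact/strspan_sub/strspanN. Qed.

Lemma strspanMn x n : strspan x -> strspan (x *+ n).
Proof.
move=> sx; elim: n => [|n IHn]; first exact: strspan0.
by rewrite mulrS; exact: strspanD.
Qed.

Lemma strspan_superdim x : strspan x -> strspan (superdim *: x).
Proof.
move=> sx; rewrite scaler_suml; apply: big_ind => [|y z|i _].
- exact: strspan0.
- exact: strspanD.
- by rewrite sgZl scale1r; case: (p i) => //=; exact: strspanN.
Qed.

Hypothesis E0v0 : forall i j, E0 i j *: v0 = 0.
Hypothesis E1v0 : forall i j, E1 i j *: v0 = 0.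
Hypothesis L0v0 : L0 *: v0 = 0.
Hypothesis T1v0 : T1 *: v0 = 0.

Lemma strspan_E0 x : strspan x -> forall i j, E0 i j *: x = 0.
Proof.
elim=> [//|y z _ y0 _ z0|k y _ y0] i j; last exact: E0_supertrace.
by rewrite scalerBr y0 z0 subr0.
Qed.

Lemma strspan_E1 x : strspan x -> forall i j, E1 i j *: x = 0.
Proof.
elim=> [//|y z _ y0 _ z0|k y sy y0] i j; first by rewrite scalerBr y0 z0 subr0.
by apply: E1_supertrace => //; exact: strspan_E0.
Qed.

Lemma strspan_L0 x : strspan x -> strspan (L0 *: x).
Proof.
elim=> [|y z _ Ly _ Lz|k y sy Ly].
- by rewrite L0v0; exact: strspan0.
- by rewrite scalerBr; exact: strspan_sub.
- by rewrite L0_supertrace; apply/strspanD/strspanMn; exact: strspan_str.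
Qed.

Lemma strspan_T1 x : strspan x -> strspan (T1 *: x).
Proof.
elim=> [|y z _ Ty _ Tz|[|k] y sy Ty].
- by rewrite T1v0; exact: strspan0.
- by rewrite scalerBr; exact: strspan_sub.
- have -> : T1 *: (supertrace (X ^+ 0) *: y) = superdim *: (T1 *: y).
    rewrite /supertrace /superdim !scaler_suml scaler_sumr.
    by apply: eq_bigr => i _; rewrite mxpow0E eqxx !sgZl sgZr !scale1r.
  exact: strspan_superdim.
rewrite T1_supertrace; last exact: strspan_E0.
apply/strspanD; first exact: strspan_str.
apply: big_ind => [|u w|q _]; [exact: strspan0|exact: strspanD|].
apply/strspan_sub; last by do 2!apply: strspan_str.
apply/strspanD; last exact/strspan_superdim/strspan_str.
apply/strspanMn/strspanD; first exact/strspan_str/strspan_L0.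
exact/strspanMn/strspan_str.
Qed.

Variable E : nat -> 'I_N -> 'I_N -> B.
Hypothesis E_0 : E 0 = E0.
Hypothesis E_1 : E 1 = E1.
Hypothesis T1E : forall r i j, T1 * E r i j = E r i j * T1 - E r.+1 i j *+ r.
Hypothesis W_torsion_free : forall (w : W) r, w *+ r.+1 = 0 -> w = 0.

(** Induction through (r + 1) e_ij[r+2] = [e_ij[r+1], T1], using the stability of [strspan] under
    [T1]. The bracket of e_ij[0] with [T1] is 0, hence the separate base case for e_ij[1]. *)
Lemma strspan_killed x r i j : strspan x -> E r i j *: x = 0.
Proof.
elim: r i j x => [|[|r] IHr] i j x sx; [rewrite E_0|rewrite E_1|].
- exact: strspan_E0.
- exact: strspan_E1.
apply: (@W_torsion_free _ r); rewrite scalerMnl.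
have -> : E r.+2 i j *+ r.+1 = E r.+1 i j * T1 - T1 * E r.+1 i j.
  by rewrite T1E opprB addrC subrK.
by rewrite scalerBl -!scalerA IHr ?IHr ?scaler0 ?subr0 //; exact: strspan_T1.
Qed.

Lemma supertrace_killed k r i j : E r i j *: (supertrace (X ^+ k) *: v0) = 0.
Proof. exact/strspan_killed/strspan_str/strspan_base. Qed.

End CriticalLevel.

(** * Linear endomorphisms and derivations *)

(* The witness [nz] makes this ring nontrivial, as [algType] requires. *)
Record lend (F : fieldType) (M : lmodType F) (x0 : M) (nz : x0 != 0) :=
  LEnd { lend_fun :> M -> M; lendP : linear lend_fun }.

Section LinearEnd.
Variables (F : fieldType) (M : lmodType F) (x0 : M) (nz : x0 != 0).
Local Notation End := (lend nz).
Implicit Types f g h : End.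

Lemma lend_eqP f g : f =1 g -> f = g.
Proof.
case: f => f fP; case: g => g gP /= fg; have {}fg : f = g by apply/funext.
by rewrite -{}fg in gP *; congr LEnd; exact: Prop_irrelevance.
Qed.

HB.instance Definition _ := gen_eqMixin End.
HB.instance Definition _ := gen_choiceMixin End.

Lemma lendD f x y : f (x + y) = f x + f y.
Proof. by rewrite -[x]scale1r lendP !scale1r. Qed.
Lemma lend0 f : f 0 = 0.
Proof. by apply: (addrI (f 0)); rewrite -lendD !addr0. Qed.
Lemma lendZ f c x : f (c *: x) = c *: f x.
Proof. by rewrite -[c *: x]addr0 lendP lend0 addr0. Qed.

Fact lend_add_linear f g : linear (fun x => f x + g x).
Proof. by move=> c x y; rewrite !lendP scalerDr addrACA. Qed.
Fact lend_opp_linear f : linear (fun x => - f x).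
Proof. by move=> c x y; rewrite lendP opprD scalerN. Qed.
Fact lend_zero_linear : linear (fun _ : M => 0 : M).
Proof. by move=> c x y; rewrite scaler0 addr0. Qed.
Fact lend_mul_linear f g : linear (f \o g).
Proof. by move=> c x y; rewrite /= !lendP. Qed.
Fact lend_one_linear : linear (@id M). Proof. by []. Qed.
Fact lend_scale_linear c f : linear (fun x => c *: f x).
Proof. by move=> d x y; rewrite lendP scalerDr !scalerA mulrC. Qed.

Definition lend_add f g : End := LEnd nz (lend_add_linear f g).
Definition lend_opp f : End := LEnd nz (lend_opp_linear f).
Definition lend_zero : End := LEnd nz lend_zero_linear.
Definition lend_mul f g : End := LEnd nz (lend_mul_linear f g).
Definition lend_one : End := LEnd nz lend_one_linear.
Definition lend_scale c f : End := LEnd nz (lend_scale_linear c f).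

Fact lend_addA : associative lend_add.
Proof. by move=> f g h; apply: lend_eqP => x /=; rewrite addrA. Qed.
Fact lend_addC : commutative lend_add.
Proof. by move=> f g; apply: lend_eqP => x /=; rewrite addrC. Qed.
Fact lend_add0 : left_id lend_zero lend_add.
Proof. by move=> f; apply: lend_eqP => x /=; rewrite add0r. Qed.
Fact lend_addN : left_inverse lend_zero lend_opp lend_add.
Proof. by move=> f; apply: lend_eqP => x /=; rewrite addNr. Qed.

HB.instance Definition _ :=
  GRing.isZmodule.Build End lend_addA lend_addC lend_add0 lend_addN.

Fact lend_mulA : associative lend_mul.
Proof. by move=> f g h; apply: lend_eqP. Qed.
Fact lend_mul1 : left_id lend_one lend_mul.
Proof. by move=> f; apply: lend_eqP. Qed.
Fact lend_mulr1 : right_id lend_one lend_mul.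
Proof. by move=> f; apply: lend_eqP. Qed.
Fact lend_mulDl : left_distributive lend_mul +%R.
Proof. by move=> f g h; apply: lend_eqP. Qed.
Fact lend_mulDr : right_distributive lend_mul +%R.
Proof. by move=> f g h; apply: lend_eqP => x; exact: lendD. Qed.
Fact lend_one_neq0 : lend_one != 0.
Proof.
by apply: contra nz => /eqP/(congr1 (fun f : End => f x0))/= ->.
Qed.

HB.instance Definition _ := GRing.Zmodule_isNzRing.Build End
  lend_mulA lend_mul1 lend_mulr1 lend_mulDl lend_mulDr lend_one_neq0.

Fact lend_scaleA c d f : lend_scale c (lend_scale d f) = lend_scale (c * d) f.
Proof. by apply: lend_eqP => x /=; rewrite scalerA. Qed.
Fact lend_scale1 : left_id 1 lend_scale.
Proof. by move=> f; apply: lend_eqP => x /=; rewrite scale1r. Qed.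
Fact lend_scaleDr : right_distributive lend_scale +%R.
Proof. by move=> c f g; apply: lend_eqP => x /=; rewrite scalerDr. Qed.
Fact lend_scaleDl f : {morph lend_scale^~ f : c d / c + d}.
Proof. by move=> c d; apply: lend_eqP => x /=; rewrite scalerDl. Qed.

HB.instance Definition _ := GRing.Zmodule_isLmodule.Build F End
  lend_scaleA lend_scale1 lend_scaleDr lend_scaleDl.

Fact lend_scaleAl c f g : c *: (f * g) = (c *: f) * g.
Proof. exact: lend_eqP. Qed.

HB.instance Definition _ := GRing.Lmodule_isLalgebra.Build F End lend_scaleAl.

Fact lend_scaleAr c f g : c *: (f * g) = f * (c *: g).
Proof. by apply: lend_eqP => x /=; rewrite [RHS]lendZ. Qed.

HB.instance Definition _ := GRing.Lalgebra_isAlgebra.Build F End lend_scaleAr.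

Lemma lend_addE f g x : (f + g) x = f x + g x. Proof. by []. Qed.
Lemma lend_mulE f g x : (f * g) x = f (g x). Proof. by []. Qed.
Lemma lend_sumE (J : Type) (r : seq J) (P : pred J) (G : J -> End) x :
  (\sum_(i <- r | P i) G i) x = \sum_(i <- r | P i) G i x.
Proof. by elim/big_rec2: _ => [|i y h _ <-]. Qed.
Lemma lend_mulrnE f n x : (f *+ n) x = f x *+ n.
Proof. by elim: n => [|n IHn] //; rewrite !mulrS -IHn. Qed.

(** A copy of [M] to carry the module structure over its endomorphism ring, beside the one over [F].
    The witness is an argument because that ring depends on it. *)
Definition lend_mod of x0 != 0 : Type := M.
Local Notation W := (lend_mod nz).
HB.instance Definition _ := GRing.Zmodule.copy W M.

Definition lend_act f (x : W) : W := f x.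

Fact lend_actA f g x : lend_act f (lend_act g x) = lend_act (f * g) x.
Proof. by []. Qed.
Fact lend_act1 : left_id 1 lend_act. Proof. by []. Qed.
Fact lend_actDr : right_distributive lend_act +%R.
Proof. by move=> f x y; exact: lendD. Qed.
Fact lend_actDl x : {morph lend_act^~ x : f g / f + g}.
Proof. by []. Qed.

HB.instance Definition _ := GRing.Zmodule_isLmodule.Build End W
  lend_actA lend_act1 lend_actDr lend_actDl.

End LinearEnd.

Section MalgLinear.
Variables (F : fieldType) (B : choiceType) (A : lalgType F) (f : B -> A).

Definition malin (x : {malg F[B]}) : A := \sum_(b <- msupp x) x@_b *: f b.

Lemma malinE x : malin x = mmap (in_alg A) f x.
Proof. by apply: eq_bigr => ? _; rewrite -mulr_algl. Qed.

Lemma malinD : {morph malin : x y / x + y}.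
Proof. by move=> x y; rewrite !malinE (mmapD (f := in_alg A)). Qed.

Lemma malinB : {morph malin : x y / x - y}.
Proof. by move=> x y; rewrite !malinE (mmapB (f := in_alg A)). Qed.

Lemma malinZU c b : malin (c *: << b >>) = c *: f b.
Proof. by rewrite malinE malgUZ mmapU mulr1 /= mulr_algl. Qed.

Lemma malin0 : malin 0 = 0.
Proof. by rewrite /malin msupp0 big_nil. Qed.

End MalgLinear.

Section Derivation.
Variables (F : fieldType) (L : superbracket F) (g : L -> uea L).
Local Notation U := (uea L).

Hypothesis g_leibniz : forall b c,
  g b * ugen c + ugen b * g c
  - (-1) ^+ (sparity b * sparity c)%N *: (g c * ugen b + ugen c * g b)
  = malin g (sbr b c).

Fact tri_witness : ((1, 0) : U * U) != 0.
Proof. by rewrite xpair_eqE oner_eq0. Qed.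

Fact tri_linear (x y : U) :
  linear (fun z : U * U => (x * z.1, x * z.2 + y * z.1) : U * U).
Proof.
move=> c z w; apply: injective_projections; rewrite /= !mulrDr -!scalerAr //.
by rewrite scalerDr addrACA.
Qed.

(* The matrix [x 0; y x]: a derivation is a lift of the identity to these. *)
Definition tri x y : lend tri_witness := LEnd tri_witness (tri_linear x y).

Lemma triM x y x' y' : tri x y * tri x' y' = tri (x * x') (y * x' + x * y').
Proof.
apply: lend_eqP => z; apply: injective_projections; rewrite /= !mulrA //.
by rewrite mulrDr mulrDl !mulrA -!addrA [X in _ + X]addrC.
Qed.

Lemma triD x y x' y' : tri x y + tri x' y' = tri (x + x') (y + y').
Proof.
apply: lend_eqP => z; apply: injective_projections; rewrite /= !mulrDl //.
by rewrite addrACA.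
Qed.

Lemma triZ c x y : c *: tri x y = tri (c *: x) (c *: y).
Proof.
apply: lend_eqP => z.
by apply: injective_projections; rewrite /= -!scalerAl // scalerDr.
Qed.

Lemma tri_inj x y x' y' : tri x y = tri x' y' -> y = y'.
Proof.
by move/(congr1 (fun f : lend tri_witness => (f (1, 0)).2));
  rewrite /= !mulr0 !add0r !mulr1.
Qed.

Lemma tri_sum (J : Type) (r : seq J) (h h' : J -> U) :
  \sum_(i <- r) tri (h i) (h' i) = tri (\sum_(i <- r) h i) (\sum_(i <- r) h' i).
Proof.
elim: r => [|i r IHr]; last by rewrite !big_cons IHr triD.
rewrite !big_nil; apply: lend_eqP => z.
by apply: injective_projections; rewrite /= !mul0r ?add0r.
Qed.

(** The diagonal entry satisfies the relations of the enveloping algebra; in the lower left entry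
    they become the Leibniz condition on [g]. *)
Lemma tri_satisfies : usatisfies (fun b : L => tri (ugen b) (g b)).
Proof.
move=> b c; rewrite !triM -[- _]scaleN1r !triZ triD.
under eq_bigr do rewrite triZ; rewrite tri_sum.
have := ugen_rel b c; rewrite /uin => <-.
by have := g_leibniz b c; rewrite /malin => <-; rewrite !scaleN1r.
Qed.

Let T := ulift (fun b : L => tri (ugen b) (g b)).

Definition uder (u : U) : U := (T u (1, 0)).2.

Let TD c u v : T (c *: u + v) = c *: T u + T v.
Proof. exact: (ulift_is_linear tri_satisfies). Qed.
Let TM u v : T (u * v) = T u * T v.
Proof. exact: (ulift_is_monoid_morphism tri_satisfies).2. Qed.
Let T1 : T 1 = 1.
Proof. exact: (ulift_is_monoid_morphism tri_satisfies).1. Qed.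

Let TE u : T u = tri u (uder u).
Proof.
suff [y Ty] : exists y, T u = tri u y.
  by rewrite /uder Ty /= mulr0 add0r mulr1.
elim/uea_ind: u => [|b|c u v [y Ty] [z Tz]|u v [y Ty] [z Tz]].
- exists 0; rewrite T1; apply: lend_eqP => -[z w].
  by apply: injective_projections; rewrite /= !mul1r // mul0r addr0.
- by exists (g b); exact: (ulift_gen tri_satisfies).
- by exists (c *: y + z); rewrite TD Ty Tz triZ triD.
- by exists (y * v + u * z); rewrite TM Ty Tz triM.
Qed.

Lemma uder_linear : linear uder.
Proof.
move=> c u v; have := TE (c *: u + v); rewrite TD !TE triZ triD.
by move/tri_inj.
Qed.

Lemma uderM u v : uder (u * v) = uder u * v + u * uder v.
Proof. by have := TE (u * v); rewrite TM !TE triM => /tri_inj. Qed.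

Lemma uder_gen b : uder (ugen b) = g b.
Proof.
by have := ulift_gen tri_satisfies b; rewrite -/T TE => /tri_inj.
Qed.

Lemma uderD u v : uder (u + v) = uder u + uder v.
Proof. by rewrite -[u]scale1r uder_linear !scale1r. Qed.
Lemma uder0 : uder 0 = 0.
Proof. by apply: (addrI (uder 0)); rewrite -uderD !addr0. Qed.
Lemma uderZ c u : uder (c *: u) = c *: uder u.
Proof. by rewrite -[c *: u]addr0 uder_linear uder0 addr0. Qed.
Lemma uderB u v : uder (u - v) = uder u - uder v.
Proof. by rewrite uderD -[- v]scaleN1r uderZ scaleN1r. Qed.
Lemma uder1 : uder 1 = 0.
Proof.
have := uderM 1 1; rewrite !mul1r !mulr1 => /eqP.
by rewrite -subr_eq0 opprD addrA subrr add0r oppr_eq0 => /eqP.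
Qed.

End Derivation.

(** * The affine algebra and its vacuum module *)

Lemma sign_nat (R : pzRingType) (k : nat) : (-1) ^+ k = (-1) ^+ odd k :> R.
Proof. by rewrite signr_odd. Qed.

Section Affine.
Variables (F : fieldType) (m n : nat).
Local Notation I := 'I_(m + n).
Local Notation gl := (glhat F m n).
Local Notation U := (uea gl).

Definition par (i : I) : bool := (m <= i)%N.

Lemma eparE (i j : I) : epar i j = par i (+) par j.
Proof. by rewrite /epar oddD !oddb. Qed.

Lemma sparity_sign (A : lmodType F) (L : superbracket F) (b c : L) (x : A) :
  (-1) ^+ (sparity b * sparity c)%N *: x = sg (sparity b && sparity c) x.
Proof. by rewrite mulnb scaler_sign. Qed.

Definition cocycle (i j k l : I) : F :=
  (n%:R - m%:R) * (k == j)%:R * (i == l)%:R * (-1) ^+ bar i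
  + (i == j)%:R * (k == l)%:R * (-1) ^+ (bar i + bar k).

Lemma malin_aff_br (T : choiceType) (A : lalgType F) (f : T -> A)
    (e : I -> I -> int -> T) (K : T) i j r k l s :
  malin f (aff_br F e K i j r k l s) =
    f (e i l (r + s)) *+ (k == j)
    - sg ((par i (+) par j) && (par k (+) par l)) (f (e k j (r + s))) *+ (i == l)
    + (cocycle i j k l * r%:~R * (r == - s)%:R) *: f K.
Proof.
rewrite /aff_br malinD malinB !malinZU scaler_nat; congr (_ - _ + _).
rewrite -scalerA scaler_nat sign_nat oddM !oddD !oddb scaler_sign.
by rewrite -/(par i) /par; case: (_ && _).
Qed.

Definition gen_e (i j : I) (r : int) : U := ugen (Some (i, j, r) : gl).
Definition gen_K : U := ugen (None : gl).

Lemma gen_e_rel i j r k l s :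
  gen_e i j r * gen_e k l s =
    sg ((par i (+) par j) && (par k (+) par l)) (gen_e k l s * gen_e i j r)
    + (gen_e i l (r + s) *+ (k == j)
    - sg ((par i (+) par j) && (par k (+) par l)) (gen_e k j (r + s)) *+ (i == l)
    + (cocycle i j k l * r%:~R * (r == - s)%:R) *: gen_K).
Proof.
rewrite -(malin_aff_br (fun b : gl => ugen b) (fun i j r => Some (i, j, r)) None).
have := ugen_rel (Some (i, j, r) : gl) (Some (k, l, s) : gl).
rewrite /uin -[X in _ = X]/(malin _ _) sparity_sign => <-.
by rewrite /= !eparE addrC subrK.
Qed.

Lemma gen_K_comm (b : gl) : ugen b * gen_K = gen_K * ugen b.
Proof.
have := ugen_rel (None : gl) b; rewrite /uin -[X in _ = X]/(malin _ _).
rewrite [sbr _ _](_ : _ = 0) ?malin0 ?mul0n ?scale1r; last by case: b => [[[]]|].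
by move=> /eqP; rewrite subr_eq0 => /eqP.
Qed.

Lemma gen_K_central (u : U) : u * gen_K = gen_K * u.
Proof.
elim/uea_ind: u => [|b|c u v uK vK|u v uK vK].
- by rewrite mul1r mulr1.
- exact: gen_K_comm.
- by rewrite mulrDl mulrDr -scalerAl -scalerAr uK vK.
- by rewrite -mulrA vK mulrA uK mulrA.
Qed.

(* The derivation - t^(a+1) d/dt. *)
Definition wder (a : int) (b : gl) : U :=
  if b is Some (i, j, r) then - r%:~R *: gen_e i j (r + a) else 0.

Lemma wder_leibniz a (b c : gl) :
  wder a b * ugen c + ugen b * wder a c
  - (-1) ^+ (sparity b * sparity c)%N *: (wder a c * ugen b + ugen c * wder a b)
  = malin (wder a) (sbr b c).
Proof.
rewrite sparity_sign; case: b c => [[[i j] r]|] [[[k l] s]|] /=;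
  rewrite ?malin0 ?mul0r ?mulr0 ?add0r ?addr0 ?andbF ?subr0 //=; last first.
- by rewrite oppr0.
- by rewrite -/gen_K gen_K_central subrr.
- by rewrite -/gen_K gen_K_central subrr.
rewrite malin_aff_br /= scaler0 addr0 -!scalerAl -!scalerAr.
rewrite -/(gen_e i j r) -/(gen_e k l s) !eparE.
rewrite (gen_e_rel i j (r + a) k l s) (gen_e_rel i j r k l (s + a)).
set b := _ && _; set c := cocycle i j k l.
rewrite !(scalerDr _ (sg b _)) !sgZr addrACA -sgD [X in _ - sg b X]addrC.
rewrite [X in X - _]addrC addrK.
rewrite (_ : r + a + s = r + s + a) 1?(addrA r) 1?addrAC //.
rewrite -[sg b (- _ *: _)]sgZr !scalerMnr -scalerBr.
set w := _ - _; move: w => w; rewrite !scalerDr !scalerA addrACA -!scalerDl.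
have -> : (r == - (s + a)) = (r + a == - s) 
  by rewrite -[LHS]subr_eq0 -[RHS]subr_eq0 !opprK addrA addrAC.
rewrite [X in _ + X *: gen_K](_ : _ = 0) ?scale0r ?addr0.
  by rewrite intrD opprD.
have [/eqP|_] := eqVneq (r + a) (- s); last by rewrite !mulr0 addr0.
rewrite -subr_eq0 opprK => /eqP ras; rewrite !mulr1.
(* The two central terms share the same delta, and their sum has the factor [r + a + s], which is 0
   on its support. *)
suff -> : - r%:~R * (c * (r + a)%:~R) + - s%:~R * (c * r%:~R)
    = - (c * r%:~R * (r + a + s)%:~R) by rewrite ras mulr0 oppr0.
rewrite !intrD; ring.
Qed.
End Affine.

(** * Power series with coefficients in a module *)

Section Sequences.
Variables (F : fieldType) (A : algType F) (W : lmodType A).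

(** Restriction of scalars from [A] to [F]: the action of an element of the noncommutative [A] is in
    general only [F]-linear. *)
Definition restr : Type := W.
HB.instance Definition _ := GRing.Zmodule.copy restr W.

Definition restr_scale (c : F) (w : restr) : restr := (c%:A : A) *: (w : W).

Fact restr_scaleA c d w : restr_scale c (restr_scale d w) = restr_scale (c * d) w.
Proof. by rewrite /restr_scale scalerA mulr_algl scalerA. Qed.
Fact restr_scale1 : left_id 1 restr_scale.
Proof. by move=> w; rewrite /restr_scale !scale1r. Qed.
Fact restr_scaleDr : right_distributive restr_scale +%R.
Proof. by move=> c v w; rewrite /restr_scale scalerDr. Qed.
Fact restr_scaleDl w : {morph restr_scale^~ w : c d / c + d}.
Proof. by move=> c d; rewrite /restr_scale !scalerDl. Qed.

HB.instance Definition _ := GRing.Zmodule_isLmodule.Build F restr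
  restr_scaleA restr_scale1 restr_scaleDr restr_scaleDl.

Variables (w0 : W) (nz0 : w0 != 0).
Local Notation M := (nat -> restr).

Fact seq_witness : (fun _ => w0 : restr) != 0 :> M.
Proof. by apply: contra nz0 => /eqP/(congr1 (fun f : M => f 0)) ->. Qed.

Local Notation End := (lend seq_witness).

Lemma seq_linE (c : F) (f g : M) k :
  (c *: f + g) k = (c%:A : A) *: (f k : W) + (g k : W).
Proof. by []. Qed.

Fact op_linear (u : A) : linear (fun (f : M) k => u *: (f k : W) : restr).
Proof.
move=> c f g; apply/funext => k.
rewrite [X in _ *: X]seq_linE scalerDr scalerA mulr_algr -mulr_algl -scalerA.
by [].
Qed.

Definition op u : End := LEnd seq_witness (op_linear u).

Lemma opE u (f : M) k : op u f k = u *: (f k : W). Proof. by []. Qed.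
Lemma op_agree_lin (c : F) (g h : End) (a b : A) (f : M) k :
  g f k = a *: (f k : W) -> h f k = b *: (f k : W) ->
  (c *: g + h) f k = (c *: a + b) *: (f k : W).
Proof.
move=> gE hE; transitivity ((c%:A : A) *: (g f k : W) + (h f k : W)) => //.
by rewrite gE hE scalerDl scalerA mulr_algl.
Qed.

Lemma op_agree_mul (g h : End) (a b : A) (f : M) k :
  (forall f' : M, g f' k = a *: (f' k : W)) -> h f k = b *: (f k : W) ->
  (g * h) f k = (a * b) *: (f k : W).
Proof. by move=> gE hE; rewrite lend_mulE gE hE scalerA. Qed.

Lemma opM u v : op (u * v) = op u * op v.
Proof. by apply: lend_eqP => f; apply/funext => k; rewrite /= -scalerA. Qed.
Lemma opD u v : op (u + v) = op u + op v.
Proof. by apply: lend_eqP => f; apply/funext => k; rewrite /= scalerDl. Qed.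
Lemma op0 : op 0 = 0.
Proof. by apply: lend_eqP => f; apply/funext => k; rewrite /= scale0r. Qed.
Lemma opZ c u : op (c *: u) = c *: op u.
Proof.
apply: lend_eqP => f; apply/funext => k.
by rewrite opE -mulr_algl -scalerA.
Qed.
Lemma opN u : op (- u) = - op u.
Proof. by rewrite -scaleN1r opZ scaleN1r. Qed.
Lemma opB u v : op (u - v) = op u - op v.
Proof. by rewrite opD opN. Qed.
Lemma op_sg b u : op (sg b u) = sg b (op u).
Proof. by case: b => //=; rewrite opN. Qed.
Lemma opMn u k : op (u *+ k) = op u *+ k.
Proof. by elim: k => [|k IHk]; rewrite ?op0 // !mulrS opD IHk. Qed.

Variables (Tm T0 Tp : W -> W).
Definition flinear (T : W -> W) :=
  forall (c : F) u v, T (c%:A *: u + v) = c%:A *: T u + T v.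
Hypotheses (Tm_lin : flinear Tm) (T0_lin : flinear T0) (Tp_lin : flinear Tp).

(* Sequences are power series in z: the three operators below are             *)
(* [Tm + z], [T0 + z d/dz] and [Tp + z d^2/dz^2].                             *)
Definition zshift (f : M) : M := fun k => if k is k'.+1 then f k' else 0.

Fact stau_linear : linear (fun (f : M) k => Tm (f k) + zshift f k : restr).
Proof.
move=> c f g; apply/funext => k.
rewrite [LHS](_ : _ = c *: (Tm (f k) : restr) + Tm (g k)
                       + (c *: zshift f k + zshift g k)).
  by rewrite addrACA -scalerDr.
by rewrite [Tm _]Tm_lin; congr (_ + _); case: k => //=; rewrite scaler0 addr0.
Qed.

Fact sL0_linear : linear (fun (f : M) k => T0 (f k) + f k *+ k : restr).
Proof.
move=> c f g; apply/funext => k.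
rewrite [T0 _]T0_lin [X in _ + X](_ : _ = c *: (f k *+ k) + g k *+ k).
  by rewrite addrACA -!scalerDr.
by rewrite -scalerMnr -mulrnDl.
Qed.

Fact sT1_linear :
  linear (fun (f : M) k => Tp (f k) + f k.+1 *+ (k.+1 * k) : restr).
Proof.
move=> c f g; apply/funext => k; set l := (k.+1 * k)%N.
rewrite [Tp _]Tp_lin [X in _ + X](_ : _ = c *: (f k.+1 *+ l) + g k.+1 *+ l).
  by rewrite addrACA -!scalerDr.
by rewrite -scalerMnr -mulrnDl.
Qed.

Definition stau : End := LEnd seq_witness stau_linear.
Definition sL0 : End := LEnd seq_witness sL0_linear.
Definition sT1 : End := LEnd seq_witness sT1_linear.

Lemma flinearD T u v : flinear T -> T (u + v) = T u + T v.
Proof. by move=> T_lin; have := T_lin 1 u v; rewrite !scale1r. Qed.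
Lemma flinear0 T : flinear T -> T 0 = 0.
Proof. by move=> T_lin; apply: (addrI (T 0)); rewrite -flinearD // !addr0. Qed.
Lemma flinearMn T u k : flinear T -> T (u *+ k) = T u *+ k.
Proof.
by move=> T_lin; elim: k => [|k IHk];
  rewrite ?flinear0 // !mulrS flinearD // IHk.
Qed.

Lemma stau_op (d : A -> A) u : (forall w, Tm (u *: w) = u *: Tm w + d u *: w) ->
  stau * op u = op u * stau + op (d u).
Proof.
move=> Tmu; apply: lend_eqP => f; apply/funext => k.
rewrite [LHS](_ : _ = Tm (u *: f k) + u *: zshift f k).
  by rewrite Tmu addrAC -scalerDr.
by congr (_ + _); case: k => //=; rewrite scaler0.
Qed.

Lemma sL0_op (d : A -> A) u : (forall w, T0 (u *: w) = u *: T0 w + d u *: w) ->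
  sL0 * op u = op u * sL0 + op (d u).
Proof.
move=> T0u; apply: lend_eqP => f; apply/funext => k.
transitivity (T0 (u *: f k) + (u *: (f k : W)) *+ k); first by [].
rewrite T0u addrAC scalerMnr -scalerDr.
by [].
Qed.

Lemma sT1_op (d : A -> A) u : (forall w, Tp (u *: w) = u *: Tp w + d u *: w) ->
  sT1 * op u = op u * sT1 + op (d u).
Proof.
move=> Tpu; apply: lend_eqP => f; apply/funext => k.
transitivity (Tp (u *: f k) + (u *: (f k.+1 : W)) *+ (k.+1 * k)); first by [].
rewrite Tpu addrAC scalerMnr -scalerDr.
by [].
Qed.

(** The z-parts commute with the coefficientwise operators and satisfy the same relation:
    [z d/dz, z] = z. *)
Lemma sL0_stau : (forall w, T0 (Tm w) = Tm (T0 w) + Tm w) ->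
  sL0 * stau = stau * sL0 + stau.
Proof.
move=> T0m; apply: lend_eqP => f; apply/funext => k.
rewrite [LHS](_ : _ = T0 (Tm (f k) + zshift f k) + (Tm (f k) + zshift f k) *+ k) //.
rewrite [RHS](_ : _ = Tm (T0 (f k) + f k *+ k) + zshift (sL0 f) k
   + (Tm (f k) + zshift f k)) //.
rewrite (flinearD _ _ T0_lin) (flinearD _ _ Tm_lin) T0m (flinearMn _ _ Tm_lin).
rewrite mulrnDl.
have -> : zshift (sL0 f) k = T0 (zshift f k) + zshift f k *+ k.-1.
  by case: k => //=; rewrite (flinear0 T0_lin) addr0.
have -> : zshift f k *+ k = zshift f k *+ k.-1 + zshift f k.
  by case: k => [|k] /=; rewrite ?addr0 // mulrSr.
by rewrite [LHS](AC (3*(1*2)) ((1*4)*(3*5)*(2*6))).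
Qed.

(** The relation [z d^2/dz^2, z] = 2 z d/dz explains the choice of z-part for [Tp]. *)
Lemma sT1_stau : (forall w, Tp (Tm w) = Tm (Tp w) + T0 w *+ 2) ->
  sT1 * stau = stau * sT1 + sL0 *+ 2.
Proof.
move=> Tpm; apply: lend_eqP => f; apply/funext => k.
rewrite lend_addE lend_mulrnE.
transitivity (Tp (Tm (f k) + zshift f k) + (Tm (f k.+1) + f k) *+ (k.+1 * k)).
  by [].
transitivity (Tm (Tp (f k) + f k.+1 *+ (k.+1 * k)) + zshift (sT1 f) k
   + (T0 (f k) + f k *+ k) *+ 2); last by rewrite mulr2n.
have -> : zshift (sT1 f) k = Tp (zshift f k) + f k *+ (k * k.-1).
  by case: k => //=; rewrite (flinear0 Tp_lin) addr0.
rewrite (flinearD _ _ Tp_lin) (flinearD _ _ Tm_lin) Tpm (flinearMn _ _ Tm_lin).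
rewrite !mulrnDl (_ : f k *+ (k.+1 * k) = f k *+ (k * k.-1) + f k *+ k *+ 2).
  by rewrite [LHS](AC (3*(1*2)) ((1*4)*(3*5)*(2*6))).
rewrite -mulrnA -mulrnDr; congr (_ *+ _); case: k => //= k.
by rewrite mulnC -mulnDr addn2.
Qed.

End Sequences.

(** * Conformal operators on the vacuum module *)

Section Vacuum.
Variables (F : fieldType) (m n : nat).
Local Notation I := 'I_(m + n).
Local Notation gl := (glhat F m n).
Local Notation U := (uea gl).
Local Notation V := (vacuum F m n).
Local Notation gen_e := (@gen_e F m n).
Local Notation gen_K := (gen_K F m n).
Local Notation wder := (@wder F m n).
Local Notation J := (lideal_spec (@vacuum_rel F m n)).
Local Notation vpi := (lpi (@vacuum_rel F m n)).

Definition wD (a : int) : U -> U := uder (wder a).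

Let leib a := @wder_leibniz F m n a.

Lemma wD_gen a b : wD a (ugen b) = wder a b.
Proof. exact: (uder_gen (leib a)). Qed.
Lemma wDM a u v : wD a (u * v) = wD a u * v + u * wD a v.
Proof. exact: (uderM (leib a)). Qed.
Lemma wD_linear a : linear (wD a). Proof. exact: (uder_linear (leib a)). Qed.
Lemma wD1 a : wD a 1 = 0. Proof. exact: (uder1 (leib a)). Qed.
Lemma wDD a u v : wD a (u + v) = wD a u + wD a v.
Proof. exact: (uderD (leib a)). Qed.
Lemma wD0 a : wD a 0 = 0. Proof. exact: (uder0 (leib a)). Qed.
Lemma wDZ a c u : wD a (c *: u) = c *: wD a u.
Proof. exact: (uderZ (leib a)). Qed.
Lemma wDB a u v : wD a (u - v) = wD a u - wD a v.
Proof. exact: (uderB (leib a)). Qed.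
Lemma wD_e a i j r : wD a (gen_e i j r) = - r%:~R *: gen_e i j (r + a).
Proof. exact: wD_gen. Qed.
Lemma wD_K a : wD a gen_K = 0. Proof. exact: wD_gen. Qed.

(** Witt relations: both sides obey the same Leibniz rule, so the check on generators suffices. *)
Lemma wD_comm a b u :
  wD a (wD b u) = wD b (wD a u) + (a - b)%:~R *: wD (a + b) u.
Proof.
elim/uea_ind: u => [|x|c u v IHu IHv|u v IHu IHv].
- by rewrite !wD1 !wD0 scaler0 addr0.
- case: x => [[[i j] r]|]; last by rewrite !wD_K !wD0 scaler0 addr0.
  rewrite -/(gen_e i j r) !wD_e !wDZ !wD_e !scalerA (addrAC r b a) (addrA r a b).
  move: (gen_e i j _) => x; rewrite -scalerDl.
  rewrite (_ : _ * _ = - r%:~R * - (r + a)%:~R + (a - b)%:~R * - r%:~R) //.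
  by rewrite !(intrD, rmorphN) /=; ring.
- rewrite !wD_linear IHu IHv !scalerDr !scalerA [_ * c]mulrC.
  by rewrite addrACA.
- rewrite !wDM !wDD !wDM IHu IHv scalerDr mulrDl mulrDr -!scalerAl -!scalerAr.
  by rewrite [LHS](AC (3*(1*2)) ((1*4)*(3*5)*(2*6))).
Qed.

Lemma lidealZ c u : J u -> J (c *: u).
Proof. by rewrite -mulr_algl; apply: Lideal_mull. Qed.

Lemma lideal_e i j (r : nat) : J (gen_e i j r).
Proof.
apply: Lideal_gen; left; exists << Some (i, j, r%:Z) : gl >>.
  move=> b; rewrite msuppU oner_eq0 in_fset1 => /eqP ->.
  by exists i, j, r.
by rewrite -[RHS]/(malin _ _) -[<< _ >>]scale1r malinZU scale1r.
Qed.

(** Only e_ij[0] could be moved out of [gl[t]], and its coefficient is 0. *)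
Lemma lideal_wder a i j (r : nat) : -1 <= a -> J (- r%:~R *: gen_e i j (r%:Z + a)).
Proof.
move=> a_ge; case: r => [|r].
  by rewrite oppr0 scale0r; exact: Lideal_0.
have : 0 <= r.+1%:Z + a by rewrite -[0](subrr 1%:Z) lerD.
by case: (_ + a) => // k _; apply/lidealZ/lideal_e.
Qed.

Lemma wD_lideal a u : -1 <= a -> J u -> J (wD a u).
Proof.
move=> a_ge; elim=> [x [[y yt ->]|->]||x y _ Jx _ Jy|v x Jx Jdx].
- rewrite /uin (big_morph _ (wDD a) (wD0 a)) big_seq.
  apply: big_ind => [||b yb]; [exact: Lideal_0|exact: Lideal_add|].
  have [i [j [r ->]]] := yt b yb.
  by rewrite wDZ wD_gen; apply/lidealZ/lideal_wder.
- by rewrite wDB wD_K wD1 subr0; exact: Lideal_0.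
- by rewrite wD0; exact: Lideal_0.
- by rewrite wDD; exact: Lideal_add.
- by rewrite wDM; apply/Lideal_add; exact: Lideal_mull.
Qed.

Lemma vpiD u v : vpi (u + v) = vpi u + vpi v.
Proof. exact: (raddfD (vpi : U^o -> V)). Qed.
Lemma vpiM u v : vpi (u * v) = u *: vpi v.
Proof.
have vpi0 : vpi 0 = 0 by exact: (raddf0 (vpi : U^o -> V)).
have := lpi_is_linear (@vacuum_rel F m n) u v 0.
by rewrite addr0 vpi0 addr0.
Qed.

Lemma vpiZ (c : F) u : vpi (c *: u) = (c%:A : U) *: vpi u.
Proof. by rewrite -vpiM mulr_algl. Qed.

(** Defined through a chosen representative; [vD_pi] shows independence of the choice for [a >= -1],
    hence that bound below. *)
Definition vD (a : int) (v : V) : V := vpi (wD a (repr v)).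

Lemma vD_pi a u : -1 <= a -> vD a (vpi u) = vpi (wD a u).
Proof.
move=> a_ge; apply/lpi_eqP; rewrite -wDB; apply: wD_lideal => //.
by apply/lpi_eqP; rewrite /lpi reprK.
Qed.

Lemma vDM a u v : -1 <= a -> vD a (u *: v) = u *: vD a v + wD a u *: v.
Proof.
move=> a_ge; elim/lpiW: v => x.
by rewrite -vpiM !vD_pi // wDM vpiD !vpiM addrC.
Qed.

Lemma vD_linear a : -1 <= a -> flinear (vD a).
Proof.
move=> a_ge c v w; elim/lpiW: v => x; elim/lpiW: w => y.
by rewrite -vpiZ -vpiD !vD_pi // wD_linear vpiD vpiZ.
Qed.

Lemma vD_comm a b v : -1 <= a -> -1 <= b -> -1 <= a + b ->
  vD a (vD b v) = vD b (vD a v) + vD (a + b) v *~ (a - b).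
Proof.
move=> a_ge b_ge ab_ge; elim/lpiW: v => x.
rewrite !vD_pi // wD_comm vpiD scaler_int; congr (_ + _).
exact: (raddfMz (vpi : {additive U^o -> V})).
Qed.

Definition vac : V := vpi 1.

Lemma vD_vac a : -1 <= a -> vD a vac = 0.
Proof. by move=> a_ge; rewrite vD_pi // wD1; exact: (raddf0 (vpi : U^o -> V)). Qed.

Lemma gen_e_vac i j (r : nat) : gen_e i j r *: vac = 0.
Proof.
rewrite -vpiM mulr1 -[0](raddf0 (vpi : U^o -> V)); apply/lpi_eqP.
by rewrite subr0; exact: lideal_e.
Qed.

(** Centrality turns [(K' - 1) x] into [x (K' - 1)], which lies in the left ideal. *)
Lemma gen_K_id (v : V) : gen_K *: v = v.
Proof.
elim/lpiW: v => x; rewrite -vpiM -gen_K_central; apply/lpi_eqP.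
by rewrite -{2}[x]mulr1 -mulrBr; apply: Lideal_mull; apply: Lideal_gen; right.
Qed.

Lemma vac_of_vac (u : U) : vpi u = u *: vac.
Proof. by rewrite -vpiM mulr1. Qed.

End Vacuum.

(** * The matrix tau + E[-1] at the critical level *)

Section ScommTheory.
Variable B : nzRingType.
Implicit Types x y z : B.

Lemma scommDl b x y z : scomm b (x + y) z = scomm b x z + scomm b y z.
Proof. by rewrite /scomm mulrDl mulrDr sgD opprD addrACA. Qed.
Lemma scommDr b x y z : scomm b x (y + z) = scomm b x y + scomm b x z.
Proof. by rewrite /scomm mulrDl mulrDr sgD opprD addrACA. Qed.
Lemma scomm_sgl b c x y : scomm b (sg c x) y = sg c (scomm b x y).
Proof. by rewrite /scomm !sgE sgB !sgE addbC. Qed.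
Lemma scomm_sgr b c x y : scomm b x (sg c y) = sg c (scomm b x y).
Proof. by rewrite /scomm !sgE sgB !sgE addbC. Qed.
Lemma scommMnl b x y k : scomm b (x *+ k) y = scomm b x y *+ k.
Proof. by rewrite /scomm mulrnAl mulrnAr sgMn mulrnBl. Qed.
Lemma scommMnr b x y k : scomm b x (y *+ k) = scomm b x y *+ k.
Proof. by rewrite /scomm mulrnAl mulrnAr sgMn mulrnBl. Qed.

End ScommTheory.

Section AffineRelations.
Variables (F : fieldType) (B : algType F) (m n : nat).
Local Notation I := 'I_(m + n).
Local Notation p := (@par m n).
Variables (E : I -> I -> int -> B) (tau L0 T1 : B).

Hypothesis EE : forall i j r k l s,
  scomm ((p i (+) p j) && (p k (+) p l)) (E i j r) (E k l s) =
    E i l (r + s) *+ (k == j)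
    - sg ((p i (+) p j) && (p k (+) p l)) (E k j (r + s)) *+ (i == l)
    + (cocycle F i j k l * r%:~R * (r == - s)%:R) *: 1.
Hypothesis tau_E : forall i j r,
  tau * E i j r = E i j r * tau - r%:~R *: E i j (r - 1).
Hypothesis L0E : forall i j r, L0 * E i j r = E i j r * L0 - r%:~R *: E i j r.
Hypothesis T1E : forall i j r,
  T1 * E i j r = E i j r * T1 - r%:~R *: E i j (r + 1).
Hypothesis L0tau : L0 * tau = tau * L0 + tau.
Hypothesis T1tau : T1 * tau = tau * T1 + L0 *+ 2.

Definition affX : 'M[B]_(m + n) :=
  \matrix_(c, d) (tau *+ (c == d) + sg (p c) (E c d (- 1))).

Lemma superdimE : superdim B p = (m%:R - n%:R)%:A.
Proof.
rewrite /superdim big_split_ord /= (eq_bigr (fun=> 1)); last first.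
  by move=> i _; rewrite /par /= leqNgt ltn_ord.
rewrite [X in _ + X](eq_bigr (fun=> - 1)); last first.
  by move=> i _; rewrite /par /= leq_addr.
by rewrite !sumr_const !card_ord mulNrn scalerBl !scaler_nat.
Qed.

(** This is where the level is seen to be critical: n - m is minus the superdimension. *)
Lemma cocycle1 i j k l : cocycle F i j k l *: (1 : B) =
  - sg (p i) (superdim B p) *+ ((k == j) && (i == l))
  + sg (p i (+) p k) 1 *+ ((i == j) && (k == l)).
Proof.
have signE (b : bool) (x : B) : (-1) ^+ b *: x = sg b x := scaler_sign b x.
rewrite superdimE /cocycle scalerDl -!mulnb !mulrnA; congr (_ + _).
  rewrite mulrC -scalerA mulr_natr mulr_natr -!scalerMnl.
  rewrite -[(-1) ^+ bar i]/((-1) ^+ par i) signE !sgMn.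
  by rewrite -sgN -scaleNr opprB.
rewrite sign_nat oddD !oddb mulrC -scalerA signE -natrM mulnb.
by rewrite scaler_nat sgMn -mulrnA mulnb.
Qed.

Lemma scomm_delta_taul a e b y :
  scomm ((p a (+) p e) && b) (tau *+ (a == e)) y = (tau * y - y * tau) *+ (a == e).
Proof.
rewrite scommMnl; have [->|_] := eqVneq a e; last by rewrite !mulr0n.
by rewrite addbb /scomm.
Qed.

Lemma scomm_delta_taur a e b y :
  scomm (b && (p a (+) p e)) y (tau *+ (a == e)) = (y * tau - tau * y) *+ (a == e).
Proof.
rewrite scommMnr; have [->|_] := eqVneq a e; last by rewrite !mulr0n.
by rewrite addbb andbF /scomm.
Qed.

Lemma tauE_commr i j r : E i j r * tau - tau * E i j r = r%:~R *: E i j (r - 1).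
Proof. by rewrite tau_E opprB addrC subrK. Qed.

Lemma tauE_comml i j r : tau * E i j r - E i j r * tau = - (r%:~R *: E i j (r - 1)).
Proof. by rewrite -tauE_commr opprB. Qed.

Lemma E0_affX i j c d :
  scomm ((p i (+) p j) && (p c (+) p d)) (E i j 0) (affX c d) =
  sg (p i (+) p j) (affX i d) *+ (c == j)
  - sg ((p i (+) p j) && (p c (+) p d)) (affX c j) *+ (i == d).
Proof.
rewrite !mxE scommDr scomm_delta_taur tauE_commr scale0r mul0rn add0r.
rewrite scomm_sgr EE add0r mulr0 scale0r addr0 sgB !sgMn sgK.
rewrite !sgD !mulrnDl opprD addrACA [X in _ = X + _](_ : _ = 0) ?add0r.
  rewrite !sgK addbC; congr (_ - _).
  by have [->|] := eqVneq c j; rewrite ?mulr0n // addbAC addbb.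
(* [tau] commutes with zero modes, so the two [tau] terms on the right must cancel each other. *)
apply/eqP; rewrite subr_eq0 !sgMn mulrnAC; apply/eqP.
have [->|_] := eqVneq i d; last by rewrite mulr0n.
have [->|_] := eqVneq c j; last by rewrite !mulr0n mul0rn.
by rewrite [p j (+) p d]addbC andbb.
Qed.

Lemma E1_affX i j c d :
  scomm ((p i (+) p j) && (p c (+) p d)) (E i j 1) (affX c d) =
  E i j 0 *+ (c == d) + sg (p j) (E i d 0) *+ (c == j)
  - sg (p c (+) ((p i (+) p j) && (p c (+) p d))) (E c j 0) *+ (i == d)
  - sg (p i (+) p j) (superdim B p) *+ ((c == j) && (i == d))
  + sg (p i) 1 *+ ((i == j) && (c == d)).
Proof.
rewrite !mxE scommDr scomm_delta_taur tauE_commr scale1r subrr.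
rewrite scomm_sgr EE subrr opprK eqxx !mulr1 cocycle1 -!addrA; congr (_ + _).
rewrite !sgD sgN !sgMn sgN !sgK mulNrn.
congr (_ + (- _ + (- _ + _))).
- by have [->|] := eqVneq c j; rewrite ?mulr0n.
- have [->|] := eqVneq c j; last by rewrite !mulr0n.
  by rewrite addbC.
- have [->|] := eqVneq i j; last by rewrite !mulr0n.
  by have [->|] := eqVneq c d; rewrite ?mulr0n //= addbCA addbb addbF.
Qed.

Lemma L0_affX c d : L0 * affX c d = affX c d * L0 + affX c d.
Proof.
rewrite mxE mulrDr mulrnAr sgMr L0tau L0E mulrDl mulrnAl sgMl mulrnDl.
by rewrite scaleN1r opprK sgD addrACA.
Qed.

Lemma T1_affX c d :
  T1 * affX c d = affX c d * T1 + (L0 *+ 2 *+ (c == d) + sg (p c) (E c d 0)).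
Proof.
rewrite mxE mulrDr mulrnAr sgMr T1tau T1E mulrDl mulrnAl sgMl mulrnDl.
by rewrite scaleN1r opprK sgD addrACA addNr.
Qed.

Lemma affX_comm a e c f :
  scomm ((p a (+) p e) && (p c (+) p f)) (affX a e) (affX c f) =
  sg (p c) (E c f (- 2)) *+ (a == e) - sg (p a) (E a e (- 2)) *+ (c == f)
  + (sg (p a (+) p c) (E a f (- 2)) *+ (c == e)
     - sg (p a (+) p c (+) ((p a (+) p e) && (p c (+) p f))) (E c e (- 2))
       *+ (a == f)).
Proof.
rewrite [affX a e]mxE [affX c f]mxE scommDl scommDr scomm_delta_taul.
rewrite scomm_delta_taul mulrnAr mulrnAl subrr mul0rn add0r.
rewrite sgMr sgMl -sgB tauE_comml scaleN1r opprK scommDr.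
rewrite scomm_delta_taur sgMl sgMr -sgB tauE_commr scaleN1r.
rewrite scomm_sgl scomm_sgr sgK EE (_ : -1 - 1 = -2) // mulr0 scale0r addr0.
by rewrite addrA !sgN mulNrn sgB !sgMn !sgK.
Qed.

(** Every term of the supercommutator is a mode -2. Exchanging [e] and [f] exchanges, up to sign,
    the terms coming from [tau] with those coming from the bracket of gl. *)
Lemma affX_manin a e c f :
  scomm ((p a (+) p e) && (p c (+) p f)) (affX a e) (affX c f) =
  - sg ((p e && p c) (+) (p f && p c) (+) (p e && p f))
      (scomm ((p a (+) p f) && (p c (+) p e)) (affX a f) (affX c e)).
Proof.
rewrite !affX_comm sgD !sgB [RHS]opprD !opprB !sgMn !sgK addrC.
congr (_ - _ + (_ - _)).
- have [->|] := eqVneq c e; last by rewrite !mulr0n.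
  by congr (sg _ _ *+ _); case: (p a); case: (p e); case: (p f).
- have [->|] := eqVneq a f; last by rewrite !mulr0n.
  by congr (sg _ _ *+ _); case: (p c); case: (p e); case: (p f).
- have [->|] := eqVneq a e; last by rewrite !mulr0n.
  by congr (sg _ _ *+ _); case: (p c); case: (p e); case: (p f).
- have [->|] := eqVneq c f; last by rewrite !mulr0n.
  by congr (sg _ _ *+ _); case: (p a); case: (p e); case: (p f).
Qed.

Hypothesis charF0 : forall k : nat, k.+1%:R != 0 :> F.
Variables (W : lmodType B) (v0 : W).
Hypothesis Ev0 : forall i j (r : nat), E i j r *: v0 = 0.
Hypothesis L0v0 : L0 *: v0 = 0.
Hypothesis T1v0 : T1 *: v0 = 0.

Theorem affX_supertrace_killed k i j (r : nat) :
  E i j r *: (supertrace p (affX ^+ k) *: v0) = 0.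
Proof.
have tf (w : W) l : w *+ l.+1 = 0 -> w = 0.
  move=> wl; have := congr1 (fun x => (l.+1%:R^-1)%:A *: x) wl.
  rewrite /= scaler0 -scaler_nat scalerA mulr_natr scalerMnl -mulr_natl.
  by rewrite mulfV ?scale1r.
apply: (@supertrace_killed _ _ _ _ _ _ _ _ _ affX_manin E0_affX
  E1_affX L0_affX T1_affX _ _ _ _ _ _ (fun r i j => E i j r%:Z)) => //.
- by move=> x /eqP; rewrite -mulr2n -scaler_nat scaler_eq0 (negPf (charF0 1)) => /eqP.
- by move=> a b; exact: (Ev0 a b 0).
- by move=> a b; exact: (Ev0 a b 1).
- by move=> s a b; rewrite T1E -scaler_nat -addn1 PoszD.
Qed.

End AffineRelations.

(** * The extended algebra acting on power series over the vacuum module *)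

Section Representation.
Variables (F : fieldType) (m n : nat).
Local Notation I := 'I_(m + n).
Local Notation gl := (glhat F m n).
Local Notation glx := (glhat_tau F m n).
Local Notation U := (uea gl).
Local Notation A := (uea glx).
Local Notation V := (vacuum F m n).
Local Notation gen_e := (@gen_e F m n).
Local Notation gen_K := (gen_K F m n).
Local Notation vac := (vac F m n).
Local Notation p := (@par m n).

Hypothesis vac_neq0 : vac != 0.
Local Notation M := (nat -> restr V).
Local Notation End := (lend (seq_witness vac_neq0)).
Local Notation op := (@op F U V vac vac_neq0).

Definition vtau : End := stau vac_neq0 (vD_linear (a := -1) (lexx _)).
Definition vL0 : End := sL0 vac_neq0 (vD_linear (a := 0) isT).
Definition vT1 : End := sT1 vac_neq0 (vD_linear (a := 1) isT).

Lemma op_K : op gen_K = 1.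
Proof. by apply: lend_eqP => f; apply/funext => k; exact: gen_K_id. Qed.

Definition vE (i j : I) (r : int) : End := op (gen_e i j r).

Lemma vE_rel i j r k l s :
  scomm ((p i (+) p j) && (p k (+) p l)) (vE i j r) (vE k l s) =
    vE i l (r + s) *+ (k == j)
    - sg ((p i (+) p j) && (p k (+) p l)) (vE k j (r + s)) *+ (i == l)
    + (cocycle F i j k l * r%:~R * (r == - s)%:R) *: 1.
Proof.
rewrite /scomm /vE -!opM gen_e_rel opD op_sg [_ + (op _)]addrC addrK.
by rewrite opD opB !opMn op_sg opZ op_K.
Qed.

Lemma vtau_E i j r : vtau * vE i j r = vE i j r * vtau - r%:~R *: vE i j (r - 1).
Proof.
rewrite /vtau /vE (@stau_op _ _ _ _ _ _ _ (@wD F m n (-1)) _).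
  by rewrite wD_e opZ scaleNr.
by move=> w; exact: vDM.
Qed.

Lemma vL0_E i j r : vL0 * vE i j r = vE i j r * vL0 - r%:~R *: vE i j r.
Proof.
rewrite /vL0 /vE (@sL0_op _ _ _ _ _ _ _ (@wD F m n 0) _).
  by rewrite wD_e opZ scaleNr addr0.
by move=> w; exact: vDM.
Qed.

Lemma vT1_E i j r : vT1 * vE i j r = vE i j r * vT1 - r%:~R *: vE i j (r + 1).
Proof.
rewrite /vT1 /vE (@sT1_op _ _ _ _ _ _ _ (@wD F m n 1) _).
  by rewrite wD_e opZ scaleNr.
by move=> w; exact: vDM.
Qed.

Lemma vL0_tau : vL0 * vtau = vtau * vL0 + vtau.
Proof. by apply: sL0_stau => w; rewrite vD_comm // subrr. Qed.

Lemma vT1_tau : vT1 * vtau = vtau * vT1 + vL0 *+ 2.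
Proof. by apply: sT1_stau => w; rewrite vD_comm. Qed.

Definition vseq : M := fun k => if k == 0%N then vac else 0.

Lemma vE_vseq i j (r : nat) : vE i j r vseq = 0.
Proof.
apply/funext => k; rewrite /vE opE /vseq.
by case: (k == 0%N); [exact: gen_e_vac|exact: (@scaler0 _ V)].
Qed.

Lemma vL0_vseq : vL0 vseq = 0.
Proof.
apply/funext => -[|k] /=; rewrite /vseq /= ?vD_vac ?mulr0n ?addr0 //.
by rewrite mul0rn addr0 (flinear0 (vD_linear _)).
Qed.

Lemma vT1_vseq : vT1 vseq = 0.
Proof.
apply/funext => -[|k] /=; rewrite /vseq /= ?vD_vac ?mul0rn ?addr0 //.
by rewrite (flinear0 (vD_linear _)).
Qed.

Definition ext_op (x : glx) : End := if x is Some y then op (ugen (y : gl)) else vtau.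

(** Multiplication by z commutes with coefficientwise operators, so [D_-1 + z] has the same brackets
    with the modes as [D_-1]. *)
Lemma ext_op_satisfies : usatisfies ext_op.
Proof.
move=> b c; rewrite -[RHS]/(malin ext_op _) sparity_sign.
case: b c => [b|] [c|].
- rewrite [LHS](_ : _ = op (uin (sbr (b : gl) (c : gl)))).
    case: b c => [[[i j] r]|] [[[k l] s]|]; rewrite -[uin _]/(malin _ _);
      rewrite ?[malin _ (sbr _ _)]malin0 ?malin0 ?op0 //.
    rewrite [malin _ (sbr (Some _ : gl) _)]malin_aff_br malin_aff_br.
    by rewrite opD opB !opMn op_sg opZ.
  by rewrite -(ugen_rel (b : gl) (c : gl)) sparity_sign opB op_sg !opM.
- rewrite andbF; case: b => [[[i j] r]|].
    by rewrite [malin _ _]malinZU [LHS](tauE_commr vtau_E).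
  by rewrite [malin _ _]malin0 [LHS]/= op_K mulr1 mul1r subrr.
- case: c => [[[i j] r]|].
    by rewrite [malin _ _]malinZU scaleNr [LHS](tauE_comml vtau_E).
  by rewrite [malin _ _]malin0 [LHS]/= op_K mulr1 mul1r subrr.
- by rewrite [malin _ _]malin0 [LHS]subrr.
Qed.

Definition rho : A -> End := ulift ext_op.

Lemma rhoM u v : rho (u * v) = rho u * rho v.
Proof. exact: (ulift_is_monoid_morphism ext_op_satisfies).2. Qed.
Lemma rho1 : rho 1 = 1.
Proof. exact: (ulift_is_monoid_morphism ext_op_satisfies).1. Qed.
Lemma rho_linear : linear rho.
Proof. exact: (ulift_is_linear ext_op_satisfies). Qed.
Lemma rhoD u v : rho (u + v) = rho u + rho v.
Proof. by rewrite -[u]scale1r rho_linear !scale1r. Qed.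
Lemma rho0 : rho 0 = 0.
Proof. by apply: (addrI (rho 0)); rewrite -rhoD !addr0. Qed.
Lemma rho_sum (T : Type) (r : seq T) (f : T -> A) :
  rho (\sum_(i <- r) f i) = \sum_(i <- r) rho (f i).
Proof. exact: (big_morph _ rhoD rho0). Qed.
Lemma rhoMn u k : rho (u *+ k) = rho u *+ k.
Proof. by elim: k => [|k IHk]; rewrite ?rho0 // !mulrS rhoD IHk. Qed.
Lemma rho_sg b u : rho (sg b u) = sg b (rho u).
Proof.
case: b => //=; rewrite -scaleN1r -[_ *: u]addr0 rho_linear rho0 addr0.
by rewrite scaleN1r.
Qed.
Lemma rhoX u k : rho (u ^+ k) = rho u ^+ k.
Proof. by elim: k => [|k IHk]; rewrite ?rho1 // !exprS rhoM IHk. Qed.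

Lemma rho_tau : rho (tau F m n) = vtau.
Proof. exact: (ulift_gen ext_op_satisfies). Qed.
Lemma rho_e i j r : rho (ugen (ext_e i j r : glx)) = vE i j r.
Proof. exact: (ulift_gen ext_op_satisfies). Qed.

Lemma rho_str_tauE k :
  rho (str (tauE F m n ^+ k)) = supertrace p (affX vE vtau ^+ k).
Proof.
have rhoX1 a b : rho (tauE F m n a b) = affX vE vtau a b.
  by rewrite !mxE rhoD rhoMn rho_tau mulr_sg rho_sg rho_e.
have rhoXk a b : rho ((tauE F m n ^+ k) a b) = (affX vE vtau ^+ k) a b.
  elim: k a b => [|k IHk] a b; first by rewrite !mxpow0E rhoMn rho1.
  by rewrite !mxpowSE rho_sum; apply: eq_bigr => c _; rewrite rhoM rhoX1 IHk.
rewrite /str rho_sum; apply: eq_bigr => a _.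
by rewrite mulr_sg rho_sg rhoXk.
Qed.

(** No [tau] occurs in the image of U(t^-1 gl[t^-1]), so it does not mix coefficients. *)
Lemma rho_uneg u (f : M) k : rho (uneg_to_ext u) f k = uneg_to_aff u *: (f k : V).
Proof.
have ext_sat := @uneg_to_ext_satisfies F m n.
have aff_sat := @uneg_to_aff_satisfies F m n.
have ext_linear : linear (@uneg_to_ext F m n) := ulift_is_linear ext_sat.
have aff_linear : linear (@uneg_to_aff F m n) := ulift_is_linear aff_sat.
have [ext1 extM] : monoid_morphism (@uneg_to_ext F m n).
  exact: ulift_is_monoid_morphism ext_sat.
have [aff1 affM] : monoid_morphism (@uneg_to_aff F m n).
  exact: ulift_is_monoid_morphism aff_sat.
elim/uea_ind: u f k => [|b|c u v IHu IHv|u v IHu IHv] f k.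
- by rewrite ext1 aff1 rho1 scale1r.
- rewrite [uneg_to_ext _](ulift_gen ext_sat) [uneg_to_aff _](ulift_gen aff_sat).
  by rewrite [rho _](ulift_gen ext_op_satisfies).
- rewrite ext_linear aff_linear rho_linear.
  exact: (op_agree_lin c (IHu f k) (IHv f k)).
- rewrite extM affM rhoM.
  exact: (op_agree_mul (fun f => IHu f k) (IHv f k)).
Qed.

(** As [D_-1] kills [vac], only z^l contributes to the power of [D_-1 + z]. *)
Lemma vtau_pow_vseq l k : (vtau ^+ l) vseq k = if k == l then vac else 0 :> V.
Proof.
elim: l k => [|l IHl] k; first by [].
rewrite exprS lend_mulE.
rewrite [LHS](_ : _ = vD (-1) ((vtau ^+ l) vseq k : V)
                      + zshift ((vtau ^+ l) vseq) k) //.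
rewrite IHl (_ : vD _ _ = 0) ?add0r.
  by case: k => [|k] //=; rewrite IHl eqSS.
by case: (k == l); rewrite ?vD_vac ?(flinear0 (vD_linear _)).
Qed.

(** Distinct [l <= k] give distinct exponents [k - l], so each coefficient of the series isolates
    one s_l. *)
Lemma rho_expansion k (s : 'I_k.+1 -> uea (glneg F m n)) (l : 'I_k.+1) :
  rho (\sum_(l < k.+1) uneg_to_ext (s l) * tau F m n ^+ (k - l)) vseq (k - l)%N
  = vac_of (s l).
Proof.
rewrite rho_sum lend_sumE fct_sumE (bigD1 l) //= big1 => [|i il].
  rewrite addr0 rhoM rhoX rho_tau lend_mulE rho_uneg vtau_pow_vseq eqxx.
  by rewrite /vac_of vac_of_vac.
rewrite rhoM rhoX rho_tau lend_mulE rho_uneg vtau_pow_vseq.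
case: eqP => [kil|_]; last exact: scaler0.
case/eqP: il; apply/val_inj => /=.
by rewrite -(subKn (leq_ord i)) -kil (subKn (leq_ord l)).
Qed.

Hypothesis charF0 : forall k : nat, k.+1%:R != 0 :> F.

Lemma gen_e_coef_killed k (s : 'I_k.+1 -> uea (glneg F m n)) l i j (r : nat) :
  tau_expansion s -> gen_e i j r *: (vac_of (s l) : V) = 0.
Proof.
move=> sE; have := @affX_supertrace_killed F End m n vE vtau vL0 vT1 vE_rel vtau_E
  vL0_E vT1_E vL0_tau vT1_tau charF0 (lend_mod (seq_witness vac_neq0)) vseq
  vE_vseq vL0_vseq vT1_vseq k i j r.
rewrite -rho_str_tauE sE => /(congr1 (fun f : M => f (k - l)%N)).
by rewrite -rho_expansion.
Qed.

End Representation.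

(** * Existence of the expansion *)

Section CommDefect.
Variables (F : fieldType) (A : algType F) (t x y x' y' : A).
Hypotheses (xE : t * x = x * t + x') (yE : t * y = y * t + y').

Lemma comm_defect_lin (c : F) :
  t * (c *: x + y) = (c *: x + y) * t + (c *: x' + y').
Proof.
by rewrite mulrDr mulrDl -scalerAl -scalerAr xE yE scalerDr addrACA.
Qed.

Lemma comm_defect_mul : t * (x * y) = x * y * t + (x * y' + x' * y).
Proof. by rewrite mulrA xE mulrDl -mulrA yE mulrDr -addrA mulrA. Qed.

End CommDefect.

Section Expansion.
Variables (F : fieldType) (m n : nat).
Local Notation U := (uea (glneg F m n)).
Local Notation A := (uea (glhat_tau F m n)).
Local Notation iota := (@uneg_to_ext F m n).
Local Notation tau := (tau F m n).
Local Notation X := (tauE F m n).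

Let ext_sat := @uneg_to_ext_satisfies F m n.

Lemma uneg_to_ext_linear : linear iota. Proof. exact: ulift_is_linear. Qed.
Lemma uneg_to_extM u v : iota (u * v) = iota u * iota v.
Proof. exact: (ulift_is_monoid_morphism ext_sat).2. Qed.
Lemma uneg_to_ext1 : iota 1 = 1.
Proof. exact: (ulift_is_monoid_morphism ext_sat).1. Qed.
Lemma uneg_to_extD u v : iota (u + v) = iota u + iota v.
Proof. by rewrite -[u]scale1r uneg_to_ext_linear !scale1r. Qed.
Lemma uneg_to_ext0 : iota 0 = 0.
Proof. by apply: (addrI (iota 0)); rewrite -uneg_to_extD !addr0. Qed.
Lemma uneg_to_ext_gen (b : glneg F m n) : iota (ugen b) = ugen (neg_to_ext b).
Proof. exact: ulift_gen. Qed.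

Lemma tau_comm u : exists v, tau * iota u = iota u * tau + iota v.
Proof.
elim/uea_ind: u => [|[[i j] a]|c u v [u' uE] [v' vE]|u v [u' uE] [v' vE]].
- by exists 0; rewrite uneg_to_ext1 uneg_to_ext0 mulr1 mul1r addr0.
(* The index [a] stands for the mode -a-1, and [tau, e_ij[-a-1]] = (a + 1) e_ij[-a-2]. *)
- exists (a.+1%:R *: ugen ((i, j, a.+1) : glneg F m n)).
  rewrite -[_ *: _]addr0 uneg_to_ext_linear uneg_to_ext0 addr0 !uneg_to_ext_gen.
  have := ugen_rel (ext_tau m n : glhat_tau F m n) (neg_to_ext (i, j, a)).
  rewrite mul0n scale1r -[uin _]/(malin _ _) [malin _ _]malinZU => /eqP.
  rewrite subr_eq addrC => /eqP ->; congr (_ + _).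
  rewrite NegzE mulrNz opprK pmulrn (_ : - _ - 1 = Negz a.+1) //.
  by rewrite NegzE -opprD -PoszD addn1.
- exists (c *: u' + v'); rewrite !uneg_to_ext_linear.
  exact: (comm_defect_lin uE vE c).
- exists (u * v' + u' * v); rewrite uneg_to_extD !uneg_to_extM.
  exact: (comm_defect_mul uE vE).
Qed.

(** Coefficients are indexed by [nat] so that shifting needs no casts between ordinals. *)
Definition expands k (x : A) :=
  exists s : nat -> U, x = \sum_(l < k.+1) iota (s l) * tau ^+ (k - l).

Lemma expandsD k x y : expands k x -> expands k y -> expands k (x + y).
Proof.
move=> [s ->] [t ->]; exists (fun l => s l + t l); rewrite -big_split.
by apply: eq_bigr => l _; rewrite uneg_to_extD mulrDl.
Qed.

Lemma expandsZ k c x : expands k x -> expands k (c *: x).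
Proof.
move=> [s ->]; exists (fun l => c *: s l); rewrite scaler_sumr.
apply: eq_bigr => l _; rewrite -[c *: s l]addr0 uneg_to_ext_linear.
by rewrite uneg_to_ext0 addr0 scalerAl.
Qed.

Lemma expands0 k : expands k 0.
Proof.
by exists (fun=> 0); rewrite big1 // => l _; rewrite uneg_to_ext0 mul0r.
Qed.

Lemma expands_sum (I : finType) k (f : I -> A) :
  (forall i, expands k (f i)) -> expands k (\sum_i f i).
Proof.
by move=> fk; apply: big_ind => //; [exact: expands0|exact: expandsD].
Qed.

Lemma expands_sg k b x : expands k x -> expands k (sg b x).
Proof. by case: b => //= kx; rewrite -scaleN1r; exact: expandsZ. Qed.

Lemma expands_shift k x : expands k x -> expands k.+1 x.
Proof.
move=> [s ->]; exists (fun l => if l is l'.+1 then s l' else 0).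
by rewrite [RHS]big_ord_recl /= uneg_to_ext0 mul0r add0r.
Qed.

Lemma expands_iotal k u x : expands k x -> expands k (iota u * x).
Proof.
move=> [s ->]; exists (fun l => u * s l); rewrite [LHS]mulr_sumr.
by apply: eq_bigr => l _; rewrite uneg_to_extM mulrA.
Qed.

(** Moving [tau] past s_l raises the power of [tau] by one and adds a term with the old power,
    absorbed by [expands_shift]. *)
Lemma expands_taul k x : expands k x -> expands k.+1 (tau * x).
Proof.
move=> [s ->]; have [v vE] := choice (fun l => tau_comm (s l)).
rewrite mulr_sumr.
under eq_bigr do rewrite mulrA vE mulrDl.
rewrite big_split; apply: expandsD; last by apply: expands_shift; exists v.
(* The raised powers of [tau] are all positive, so the coefficient of index [k.+1], that of
   [tau ^+ 0], is 0. *)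
exists (fun l => if (l <= k)%N then s l else 0).
rewrite [RHS]big_ord_recr /= ltnn uneg_to_ext0 mul0r addr0; apply: eq_bigr => l _.
by rewrite leq_ord -mulrA -exprS subSn // leq_ord.
Qed.

Lemma expands_tauE k (i j : 'I_(m + n)) : expands k ((X ^+ k) i j).
Proof.
elim: k i j => [|k IHk] i j.
  exists (fun=> (i == j)%:R); rewrite big_ord1 mxpow0E mulr1.
  by case: (i == j); rewrite ?uneg_to_ext1 ?uneg_to_ext0.
rewrite mxpowSE; apply: expands_sum => c; rewrite mxE mulrDl mulr_sg.
apply: expandsD.
  by rewrite mulrnAl -scaler_nat; apply/expandsZ/expands_taul.
have -> : ugen (ext_e i c (-1) : glhat_tau F m n) =
    iota (ugen ((i, c, 0%N) : glneg F m n)).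
  by rewrite uneg_to_ext_gen.
by rewrite sgMl; apply/expands_sg/expands_shift/expands_iotal.
Qed.

Lemma tau_expansion_exists k : exists s : 'I_k.+1 -> U, tau_expansion s.
Proof.
have [s sE] : expands k (str (X ^+ k)).
  apply: expands_sum => a; rewrite mulr_sg.
  exact/expands_sg/expands_tauE.
by exists (fun l => s l).
Qed.

End Expansion.

(** * Segal-Sugawara vectors *)

Lemma coef_segal_sugawara (F : fieldType) (m n k : nat)
    (s : 'I_k.+1 -> uea (glneg F m n)) (l : 'I_k.+1) :
  (forall k : nat, k.+1%:R != 0 :> F) ->
  tau_expansion s -> segal_sugawara (vac_of (s l)).
Proof.
move=> charF0 sE x xt; rewrite /uin scaler_suml big_seq big1 // => b xb.
have [i [j [r ->]]] := xt b xb.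
(* The representation on series was built for a nonzero vacuum vector; if [vac] is 0, so is the
   module that it generates. *)
have [v0|vN0] := eqVneq (vac F m n) 0.
  by rewrite [vac_of _]vac_of_vac v0 !scaler0.
have H := gen_e_coef_killed vN0 charF0 l i j r sE.
by rewrite -mulr_algl -scalerA H scaler0.
Qed.

Theorem theorem3p2 (R : realType) (m n k : nat) (hmn : (0 < m + n)%N) :
  (exists s : 'I_k.+1 -> uea (glneg R[i] m n), tau_expansion s) /\
  (forall s : 'I_k.+1 -> uea (glneg R[i] m n),
     tau_expansion s -> forall l : 'I_k.+1, segal_sugawara (vac_of (s l))).
Proof.
split=> [|s sE l]; first exact: tau_expansion_exists.
by apply: coef_segal_sugawara sE => r; rewrite pnatr_eq0.
Qed.
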